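(* For any outerplanar graph $G=(V,E)$, we have $\mu_{int}(G)\leq 2$. That is, there is an improper interval edge coloring $c:E\to \mathbb{Z}$ such that for any vertex $v\in V$ and any color $i\in \mathbb{Z}$, $|c^{-1}(i) \cap E_v|\leq 2$.
   Context: All graphs are finite and simple. For a graph $G=(V,E)$ and a vertex $v\in V$, $E_v$ denotes the set of edges of $G$ incident with $v$. An edge coloring $c:E\to\mathbb{Z}$ (not necessarily proper) is called an improper interval edge coloring if for every $v\in V$ the image $c(E_v)$ is an integral interval, i.e. a set of consecutive integers (the empty set, which occurs when $v$ is isolated, counts as an interval). The interval coloring impropriety $\mu_{int}(G)$ is the smallest value $k$ such that $G$ has an improper interval edge coloring $c$ in which at most $k$ edges with a common endpoint have the same color, i.e. $|c^{-1}(i)\cap E_v|\leq k$ for every color $i\in\mathbb{Z}$ and every vertex $v\in V$. An outerplanar graph is a graph that has a planar drawing in which all vertices belong to the outer face of the drawing. *)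

(* Defs.v *)
(* Graphs are over a finType; the plane is R * R for R : realType, with the
   topology and norm of MathComp-Analysis. *)
From HB Require Import structures.
From mathcomp Require Import all_boot all_order all_algebra.
From mathcomp Require Import all_classical all_reals all_analysis.

Set Implicit Arguments.
Unset Strict Implicit.
Unset Printing Implicit Defensive.

Import Order.TTheory GRing.Theory Num.Theory.
Import numFieldNormedType.Exports.

Local Open Scope classical_set_scope.
Local Open Scope ring_scope.

Record graph := Graph {
  vertex :> finType;
  adj : rel vertex;
  adj_sym : symmetric adj;
  adj_irr : irreflexive adj }.

Definition edges (G : graph) : {set {set G}} :=
  [set e : {set G} | [exists x, exists y, adj x y && (e == [set x; y]%SET)]]%SET.

Definition incident (G : graph) (v : G) : {set {set G}} :=
  [set e in edges G | v \in e]%SET.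

(* A coloring assigns an integer to every set of vertices, but only its values
   on the edges matter. *)
(* At int, the order-convexity [is_interval] says that the finite set of colors
   at v consists of consecutive integers; it holds for the empty set. *)
Definition improper_interval_coloring (G : graph) (c : {set G} -> int) : Prop :=
  forall v : G, is_interval (c @` [set` incident v]).

Definition impropriety_le (G : graph) (c : {set G} -> int) (k : nat) : Prop :=
  forall (v : G) (i : int), (#|[set e in incident v | c e == i]%SET| <= k)%N.

Definition has_impropriety (G : graph) (k : nat) : Prop :=
  exists c : {set G} -> int,
    improper_interval_coloring c /\ impropriety_le c k.

Lemma has_impropriety_ex (G : graph) : exists k, `[< has_impropriety G k >].
Proof.
exists #|edges G|; apply/asboolP; exists (fun=> 0); split.
- move=> v _ _ [e ev <-] [_ _ <-] z z0; exists e => //.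
  by apply/eqP; rewrite eq_le.
- move=> v i; apply/subset_leq_card/fintype.subsetP => e.
  by rewrite !inE => /andP[/andP[]].
Qed.

Definition mu_int (G : graph) : nat := ex_minn (has_impropriety_ex G).

(* [pos] places the vertices, and [arc e] restricted to [0, 1] is a simple
   (continuous, injective) curve drawing the edge e. *)
Record planar_drawing (R : realType) (G : graph)
    (pos : G -> R * R) (arc : {set G} -> R -> R * R) : Prop := PlanarDrawing {
  pos_inj : injective pos;
  arc_continuous : forall e : {set G}, e \in edges G ->
    {within `[0, 1], continuous (arc e)};
  arc_inj : forall e : {set G}, e \in edges G -> {in `[0, 1] &, injective (arc e)};
  arc_ends : forall e : {set G}, e \in edges G ->
    [set arc e 0; arc e 1] = pos @` [set` e];
  arc_vertex : forall (e : {set G}) (v : G) (t : R), e \in edges G -> t \in `]0, 1[ ->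
    arc e t <> pos v;
  arc_disjoint : forall (e f : {set G}) (t u : R), e \in edges G -> f \in edges G -> e != f ->
    t \in `]0, 1[ -> u \in `]0, 1[ -> arc e t <> arc f u }.

Definition drawing_support (R : realType) (G : graph)
    (pos : G -> R * R) (arc : {set G} -> R -> R * R) : set (R * R) :=
  range pos `|` \bigcup_(e in [set` edges G]) (arc e @` `[0, 1]).

(* The support X of a drawing is compact, so its complement has exactly one
   unbounded connected component. *)
Definition outer_face (R : realType) (X : set (R * R)) : set (R * R) :=
  [set p | (~` X) p /\ ~ bounded_set (connected_component (~` X) p)].

(* The vertices lie on X, hence outside the open set [outer_face X]: they belong
   to the outer face when they are on its boundary, i.e. in its closure. *)
Definition outerplanar (R : realType) (G : graph) : Prop :=
  exists (pos : G -> R * R) (arc : {set G} -> R -> R * R),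
    planar_drawing pos arc /\
    forall v : G, closure (outer_face (drawing_support pos arc)) (pos v).

(* Main.v *)
(* Planarity enters only modulo 2.  Add to the drawing an apex z in the outer face,
   joined to every vertex inside that face up to a short segment near the vertex;
   in the resulting drawing, edges without a common end are still disjoint.  For a
   curve f and a point v off f, let n(v, f) be the parity of the number of times
   that f - v crosses the positive x-axis, and let u(x, y) say whether x - y is in
   the upper half plane.  For disjoint edges ab and cd, the loop of differences
   around the square ab x cd bounds a disk in the plane minus the origin, so
     n(a, cd) + n(b, cd) + n(c, ab) + n(d, ab) = u(a, d) + u(b, d) + u(a, c) + u(b, c)
   modulo 2.  These relations add up along walks, and summing them over all pairs
   of disjoint edges of K_{3,3} or of K_5 gives 0 = 1.  Hence G has no theta with
   three nonempty branches (it gives K_{3,3} with z) and no K_4 (it gives K_5).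

   To colour G, split it along vertices whose removal disconnects it: the two
   palettes met at such a vertex are stacked by a shift.  A part without such
   vertices is built by adding ears to a cycle, starting from an edge seen as a
   cycle of length two.  At each vertex of the cycle, the colours of the two
   incident cycle edges are kept equal to the two ends of the palette, and each
   cycle edge is kept the only one of its colour at one of its ends.  By the
   excluded subgraphs, a shortest ear joins two consecutive vertices of the cycle
   and is otherwise unattached.  If it replaces an edge of colour a, its edges get
   the colours a+1 or a-1 and a alternately, so that palettes grow by one step or,
   at most once per ear, repeat the colour a where it occurred only once. *)
Require Import Defs.
From mathcomp Require Import all_boot all_order all_algebra.
From mathcomp Require Import boolp zify.
From Stdlib Require Btauto.

Set Implicit Arguments.
Unset Strict Implicit.
Unset Printing Implicit Defensive.

Import Order.TTheory GRing.Theory Num.Theory.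

(** * The mod 2 obstruction of van Kampen *)

Lemma addb_xorb (a b : bool) : a (+) b = xorb a b.
Proof. by case: a; case: b. Qed.

Lemma addb_eqD (a b c d : bool) : a = b -> c = d -> a (+) c = b (+) d.
Proof. by move=> -> ->. Qed.

Lemma addb_eq_from (a b c d : bool) : a = b -> a (+) b (+) (c (+) d) = false -> c = d.
Proof. by move=> ->; case: b; case: c; case: d. Qed.

Ltac xor_from H :=
  apply: (addb_eq_from H); rewrite ?addb_xorb; Btauto.btauto.

Fixpoint wsum (A : Type) (f : A -> A -> bool) (x : A) (p : seq A) : bool :=
  if p is y :: q then f x y (+) wsum f y q else false.

(** Sum the relation of a single square over the grid of all pairs of a step of [x :: p] and a step
    of [y :: q]. Terms on a side shared by two squares, and [U] at corners that are not corners of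
    the grid, occur an even number of times and cancel. The auxiliary [row] handles one step of
    [p]. *)
Lemma wsum_square (A B : eqType) (eA : rel A) (eB : rel B)
    (F : A -> B -> B -> bool) (G : B -> A -> A -> bool) (U : A -> B -> bool)
    (x : A) (p : seq A) (y : B) (q : seq B) :
  (forall a a' b b', a \in x :: p -> a' \in x :: p -> eA a a' ->
     b \in y :: q -> b' \in y :: q -> eB b b' ->
     F a b b' (+) F a' b b' (+) G b a a' (+) G b' a a'
     = U a b' (+) U a' b' (+) U a b (+) U a' b) ->
  path eA x p -> path eB y q ->
  wsum (F x) y q (+) wsum (F (last x p)) y q (+)
  wsum (G y) x p (+) wsum (G (last y q)) x p
  = U x (last y q) (+) U (last x p) (last y q) (+) U x y (+) U (last x p) y.
Proof.
have row a a' z r : path eB z r ->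
    (forall b b', b \in z :: r -> b' \in z :: r -> eB b b' ->
     F a b b' (+) F a' b b' (+) G b a a' (+) G b' a a'
     = U a b' (+) U a' b' (+) U a b (+) U a' b) ->
    wsum (F a) z r (+) wsum (F a') z r (+) G z a a' (+) G (last z r) a a'
    = U a (last z r) (+) U a' (last z r) (+) U a z (+) U a' z.
  elim: r z => [|b r IH] z /=.
    by move=> _ _; case: (G _ _ _); case: (U _ _); case: (U _ _).
  case/andP=> zb pr sq.
  have sub i : i \in b :: r -> i \in [:: z, b & r] by move=> h; rewrite inE h orbT.
  have e1 := sq z b (mem_head _ _) (sub _ (mem_head _ _)) zb.
  have e2 := IH b pr (fun b1 b2 i1 i2 => sq b1 b2 (sub _ i1) (sub _ i2)).
  by xor_from (addb_eqD e1 e2).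
move=> sq + pq; elim: p x sq => [|a p IH] x /= sq.
  by move=> _; rewrite ?addb_xorb; Btauto.btauto.
case/andP=> xa pp.
have sub i : i \in a :: p -> i \in [:: x, a & p] by move=> h; rewrite inE h orbT.
have e1 := row x a y q pq (fun b b' i i' eb =>
  sq x a b b' (mem_head _ _) (sub _ (mem_head _ _)) xa i i' eb).
have e2 := IH a (fun a1 a2 b b' i1 i2 => sq a1 a2 b b' (sub _ i1) (sub _ i2)) pp.
by xor_from (addb_eqD e1 e2).
Qed.

(* The mod 2 van Kampen obstruction of a graph with edges [e] vanishes. *)
Definition vk_trivial (A : eqType) (e : rel A) (u : rel A)
    (n : A -> A -> A -> bool) : Prop :=
  (forall x y, x != y -> u x y = ~~ u y x) /\
  (forall a b c d, e a b -> e c d ->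
     a != c -> a != d -> b != c -> b != d ->
     n a c d (+) n b c d (+) n c a b (+) n d a b
     = u a d (+) u b d (+) u a c (+) u b c).

(** * Contradictions from K_{3,3} and K_5 realised by walks *)

Section VanKampen.
Variables (A : eqType) (e u : rel A) (n : A -> A -> A -> bool).
Hypothesis vk : vk_trivial e u n.

(** Edges taken from two disjoint walks have no common end, so [vk] supplies the relation on every
    square of the grid. *)
Lemma vk_walks (a : A) (p : seq A) (c : A) (q : seq A) :
  path e a p -> path e c q -> ~~ has (mem (c :: q)) (a :: p) ->
  wsum (n a) c q (+) wsum (n (last a p)) c q (+)
  wsum (n c) a p (+) wsum (n (last c q)) a p
  = u a (last c q) (+) u (last a p) (last c q) (+) u a c (+) u (last a p) c.
Proof.
move=> pp pq /hasPn dis; apply: (@wsum_square _ _ e e) => //.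
have ne x y : x \in a :: p -> y \in c :: q -> x != y.
  by move=> ix iy; apply/eqP => xy; case/negP: (dis _ ix); rewrite xy.
by move=> x x' y y' xp xp' exx yq yq' eyy; apply: (proj2 vk); rewrite ?ne.
Qed.

(** The walks [w v x] are the edges of a K_{3,3} with sides [a], [b], [z] and [x1], [x2], [x3]. Only
    walks for edges without a common end have to be disjoint, since these are the pairs that enter
    the sum. *)
Lemma vk_K33 (a b z x1 x2 x3 : A) (w : A -> A -> seq A) :
  uniq [:: a; b; z; x1; x2; x3] ->
  {in [:: a; b; z] & [:: x1; x2; x3], forall v x,
     path e v (w v x) /\ last v (w v x) = x} ->
  {in [:: a; b; z] & [:: a; b; z], forall v v', v != v' ->
   {in [:: x1; x2; x3] & [:: x1; x2; x3], forall x x', x != x' ->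
     ~~ has (mem (v' :: w v' x')) (v :: w v x)}} ->
  False.
Proof.
move=> un pw dw.
have key v v' x x' : v \in [:: a; b; z] -> v' \in [:: a; b; z] -> v != v' ->
    x \in [:: x1; x2; x3] -> x' \in [:: x1; x2; x3] -> x != x' ->
    wsum (n v) v' (w v' x') (+) wsum (n x) v' (w v' x') (+)
    wsum (n v') v (w v x) (+) wsum (n x') v (w v x)
    = u v x' (+) u x x' (+) u v v' (+) u x v'.
  move=> iv iv' nv ix ix' nx.
  have [p1 l1] := pw v x iv ix; have [p2 l2] := pw v' x' iv' ix'.
  by have := vk_walks p1 p2 (dw v v' iv iv' nv x x' ix ix' nx); rewrite l1 l2.
move: un; rewrite /= !inE !negb_or -!andbA => /andP[n1] /andP[n2] /andP[n3] /andP[n4] /andP[n5].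
move=> /andP[n6] /andP[n7] /andP[n8] /andP[n9] /andP[n10] /andP[n11] /andP[n12] /andP[n13].
move=> /andP[n14] /andP[n15] _.
have us := proj1 vk.
suff: false = true by [].
have K v v' x x' i1 i2 i3 i4 := fun i5 i6 => key v v' x x' i1 i2 i5 i3 i4 i6.
have [ia ib iz] : [/\ a \in [:: a; b; z], b \in [:: a; b; z] & z \in [:: a; b; z]].
  by rewrite !inE !eqxx !orbT.
have [j1 j2 j3] :
    [/\ x1 \in [:: x1; x2; x3], x2 \in [:: x1; x2; x3] & x3 \in [:: x1; x2; x3]].
  by rewrite !inE !eqxx !orbT.
(* In the sum of these 18 relations every n-term occurs twice, while the u-terms
   cancel up to an odd number of uses of antisymmetry. *)
have := K a b x1 x2 ia ib j1 j2 n1 n13.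
move/addb_eqD/(_ (K a b x1 x3 ia ib j1 j3 n1 n14)).
move/addb_eqD/(_ (K a b x2 x3 ia ib j2 j3 n1 n15)).
rewrite eq_sym in n13; rewrite eq_sym in n14; rewrite eq_sym in n15.
move/addb_eqD/(_ (K a b x2 x1 ia ib j2 j1 n1 n13)).
move/addb_eqD/(_ (K a b x3 x1 ia ib j3 j1 n1 n14)).
move/addb_eqD/(_ (K a b x3 x2 ia ib j3 j2 n1 n15)).
move/addb_eqD/(_ (K a z x2 x1 ia iz j2 j1 n2 n13)).
move/addb_eqD/(_ (K a z x3 x1 ia iz j3 j1 n2 n14)).
move/addb_eqD/(_ (K a z x3 x2 ia iz j3 j2 n2 n15)).
move/addb_eqD/(_ (K b z x2 x1 ib iz j2 j1 n6 n13)).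
move/addb_eqD/(_ (K b z x3 x1 ib iz j3 j1 n6 n14)).
move/addb_eqD/(_ (K b z x3 x2 ib iz j3 j2 n6 n15)).
rewrite eq_sym in n13; rewrite eq_sym in n14; rewrite eq_sym in n15.
move/addb_eqD/(_ (K a z x1 x2 ia iz j1 j2 n2 n13)).
move/addb_eqD/(_ (K a z x1 x3 ia iz j1 j3 n2 n14)).
move/addb_eqD/(_ (K a z x2 x3 ia iz j2 j3 n2 n15)).
move/addb_eqD/(_ (K b z x1 x2 ib iz j1 j2 n6 n13)).
move/addb_eqD/(_ (K b z x1 x3 ib iz j1 j3 n6 n14)).
move/addb_eqD/(_ (K b z x2 x3 ib iz j2 j3 n6 n15)).
rewrite (us _ _ n1) (us _ _ n2) (us _ _ n3) (us _ _ n4) (us _ _ n5) (us _ _ n6).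
rewrite (us _ _ n7) (us _ _ n8) (us _ _ n9) (us _ _ n13) (us _ _ n14) (us _ _ n15) => H.
by xor_from H.
Qed.

Lemma vk_K5 (a b c d z : A) (w : A -> A -> seq A)
    (es := [:: (a, b); (b, c); (c, a); (d, a); (d, b); (d, c);
               (z, a); (z, b); (z, c); (z, d)]) :
  uniq [:: a; b; c; d; z] ->
  (forall x y, (x, y) \in es -> path e x (w x y) /\ last x (w x y) = y) ->
  (forall x y x' y', (x, y) \in es -> (x', y') \in es ->
     uniq [:: x; y; x'; y'] -> ~~ has (mem (x' :: w x' y')) (x :: w x y)) ->
  False.
Proof.
move=> un pw dw.
have key x y x' y' : (x, y) \in es -> (x', y') \in es -> uniq [:: x; y; x'; y'] ->
    wsum (n x) x' (w x' y') (+) wsum (n y) x' (w x' y') (+)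
    wsum (n x') x (w x y) (+) wsum (n y') x (w x y)
    = u x y' (+) u y y' (+) u x x' (+) u y x'.
  move=> ixy ixy' U.
  have [p1 l1] := pw x y ixy; have [p2 l2] := pw x' y' ixy'.
  by have := vk_walks p1 p2 (dw x y x' y' ixy ixy' U); rewrite l1 l2.
have us := proj1 vk; suff: false = true by [].
move: un; rewrite /= !inE !negb_or -!andbA.
case/andP=> nab /andP[nac] /andP[nad] /andP[naz] /andP[nbc] /andP[nbd] /andP[nbz].
case/andP=> ncd /andP[ncz] /andP[ndz] _.
have iab : (a, b) \in es by rewrite !inE eqxx ?orbT.
have ibc : (b, c) \in es by rewrite !inE eqxx ?orbT.
have ica : (c, a) \in es by rewrite !inE eqxx ?orbT.
have ida : (d, a) \in es by rewrite !inE eqxx ?orbT.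
have idb : (d, b) \in es by rewrite !inE eqxx ?orbT.
have idc : (d, c) \in es by rewrite !inE eqxx ?orbT.
have iza : (z, a) \in es by rewrite !inE eqxx ?orbT.
have izb : (z, b) \in es by rewrite !inE eqxx ?orbT.
have izc : (z, c) \in es by rewrite !inE eqxx ?orbT.
have izd : (z, d) \in es by rewrite !inE eqxx ?orbT.
have ne (x y : A) : x != y -> (x != y) && (y != x) by move=> xy; rewrite xy eq_sym.
case/andP: (ne _ _ nab) => {}nab nab'.
case/andP: (ne _ _ nac) => {}nac nac'.
case/andP: (ne _ _ nad) => {}nad nad'.
case/andP: (ne _ _ naz) => {}naz naz'.
case/andP: (ne _ _ nbc) => {}nbc nbc'.
case/andP: (ne _ _ nbd) => {}nbd nbd'.
case/andP: (ne _ _ nbz) => {}nbz nbz'.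
case/andP: (ne _ _ ncd) => {}ncd ncd'.
case/andP: (ne _ _ ncz) => {}ncz ncz'.
case/andP: (ne _ _ ndz) => {}ndz ndz'.
have U4 (x y x' y' : A) : x != y -> x != x' -> x != y' -> y != x' -> y != y' ->
    x' != y' -> uniq [:: x; y; x'; y'].
  by rewrite /= !inE !negb_or => -> -> -> -> -> ->.
(* These are the 15 pairs of disjoint edges of K_5. Every n-term occurs twice and every pair of
   vertices six times in u-terms; orienting these pairs by antisymmetry leaves an odd number of
   negations. *)
have := key _ _ _ _ iab idc (U4 _ _ _ _ nab nad nac nbd nbc ncd').
move/addb_eqD/(_ (key _ _ _ _ iab izc (U4 _ _ _ _ nab naz nac nbz nbc ncz'))).
move/addb_eqD/(_ (key _ _ _ _ iab izd (U4 _ _ _ _ nab naz nad nbz nbd ndz'))).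
move/addb_eqD/(_ (key _ _ _ _ ibc ida (U4 _ _ _ _ nbc nbd nab' ncd nac' nad'))).
move/addb_eqD/(_ (key _ _ _ _ ibc iza (U4 _ _ _ _ nbc nbz nab' ncz nac' naz'))).
move/addb_eqD/(_ (key _ _ _ _ ibc izd (U4 _ _ _ _ nbc nbz nbd ncz ncd ndz'))).
move/addb_eqD/(_ (key _ _ _ _ ica idb (U4 _ _ _ _ nac' ncd nbc' nad nab nbd'))).
move/addb_eqD/(_ (key _ _ _ _ ica izb (U4 _ _ _ _ nac' ncz nbc' naz nab nbz'))).
move/addb_eqD/(_ (key _ _ _ _ ica izd (U4 _ _ _ _ nac' ncz ncd naz nad ndz'))).
move/addb_eqD/(_ (key _ _ _ _ ida izb (U4 _ _ _ _ nad' ndz nbd' naz nab nbz'))).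
move/addb_eqD/(_ (key _ _ _ _ ida izc (U4 _ _ _ _ nad' ndz ncd' naz nac ncz'))).
move/addb_eqD/(_ (key _ _ _ _ idb iza (U4 _ _ _ _ nbd' ndz nad' nbz nab' naz'))).
move/addb_eqD/(_ (key _ _ _ _ idb izc (U4 _ _ _ _ nbd' ndz ncd' nbz nbc ncz'))).
move/addb_eqD/(_ (key _ _ _ _ idc iza (U4 _ _ _ _ ncd' ndz nad' ncz nac' naz'))).
move/addb_eqD/(_ (key _ _ _ _ idc izb (U4 _ _ _ _ ncd' ndz nbd' ncz nbc' nbz'))).
rewrite ?(us _ _ nab) ?(us _ _ nac) ?(us _ _ nad) ?(us _ _ naz) ?(us _ _ nbc).
rewrite ?(us _ _ nbd) ?(us _ _ nbz) ?(us _ _ ncd) ?(us _ _ ncz) ?(us _ _ ndz) => H.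
by xor_from H.
Qed.

End VanKampen.

(** * Thetas and K_4 excluded with the help of an apex *)

Section Apex.
Variables (T : eqType) (adj : rel T).
Hypothesis adj_sym : symmetric adj.

(* Apex edges are directed away from the apex [None]. *)
Definition apex (x y : option T) : bool :=
  match x, y with
  | None, Some _ => true
  | Some x, Some y => adj x y
  | _, None => false
  end.

Variables (u : rel (option T)) (n : option T -> option T -> option T -> bool).
Hypothesis vk : vk_trivial apex u n.

Lemma apex_path x p : path apex (Some x) (map Some p) = path adj x p.
Proof. by elim: p x => //= y p IH x; rewrite IH. Qed.

Lemma mem_map_Some (x : T) (p : seq T) : (Some x \in map Some p) = (x \in p).
Proof. by rewrite mem_map// => ? ? []. Qed.

Lemma None_map_Some (p : seq T) : (None \in map Some p) = false.
Proof. by apply/mapP => -[]. Qed.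

Lemma rev_walk a p b : path adj a (rcons p b) = path adj b (rcons (rev p) a).
Proof.
have := rev_path adj a (rcons p b); rewrite last_rcons belast_rcons rev_cons => ->.
by apply: eq_path => x y; rewrite adj_sym.
Qed.

(** [p] lists the inner vertices of a walk, possibly with repetitions. It is nonempty because the
    first inner vertices of three links become one side of a K_{3,3}. *)
Definition link (a b : T) (p : seq T) : bool :=
  [&& p != [::], path adj a (rcons p b), a \notin p & b \notin p].

Definition theta_free : Prop := forall a b p1 p2 p3, a != b ->
  link a b p1 -> link a b p2 -> link a b p3 ->
  ~~ has (mem p1) p2 -> ~~ has (mem p1) p3 -> ~~ has (mem p2) p3 -> False.

(* The walks from [d] may overlap: only disjoint edges of K_5 are compared. *)
Definition K4_free : Prop := forall a b c d pa pb pc, uniq [:: a; b; c; d] ->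
  adj a b -> adj b c -> adj c a ->
  path adj d (rcons pa a) -> path adj d (rcons pb b) -> path adj d (rcons pc c) ->
  ~~ has (mem [:: a; b; c]) (pa ++ pb ++ pc) -> False.

(** The first vertices [x1], [x2], [x3] of the branches, against [a], [b] and the apex, form a
    K_{3,3}: [a] and the apex reach each of them by an edge, [b] by following its branch
    backwards. *)
Lemma vk_theta_free : theta_free.
Proof.
move=> a b p1 p2 p3; case: p1 => // x1 p1; case: p2 => // x2 p2; case: p3 => // x3 p3.
move=> ab l1 l2 l3 d12 d13 d23.
pose P (x : option T) := if x == Some x1 then x1 :: p1 else
  if x == Some x2 then x2 :: p2 else x3 :: p3.
pose w (v x : option T) := if v == Some b then map Some (rev (P x)) else [:: x].
have [x12 x13 x23] : [/\ x1 != x2, x1 != x3 & x2 != x3].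
  split; apply/eqP => E; [case/negP: d12 | case/negP: d13 | case/negP: d23];
  by rewrite /= E inE eqxx.
have P1 : P (Some x1) = x1 :: p1 by rewrite /P eqxx.
have P2 : P (Some x2) = x2 :: p2 by rewrite /P (inj_eq Some_inj) eq_sym (negbTE x12) eqxx.
have P3 : P (Some x3) = x3 :: p3.
  by rewrite /P !(inj_eq Some_inj) eq_sym (negbTE x13) eq_sym (negbTE x23).
set X := [:: Some x1; Some x2; Some x3].
have PX x : x \in X -> exists y q, [/\ x = Some y, P x = y :: q & link a b (y :: q)].
  rewrite !inE => /or3P[] /eqP ->; rewrite ?P1 ?P2 ?P3;
    by [exists x1, p1 | exists x2, p2 | exists x3, p3].
apply: (@vk_K33 _ _ _ _ vk (Some a) (Some b) None (Some x1) (Some x2) (Some x3) w).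
- have [y1 [q1 [e1 e1' k1]]] := PX (Some x1) (mem_head _ _).
  move: l1 l2 l3; rewrite /link /= !inE !negb_or -!andbA.
  case/and5P=> _ _ a1 _ /andP[b1 _] /and5P[_ _ a2 _ /andP[b2 _]] /and5P[_ _ a3 _ /andP[b3 _]].
  by rewrite /= !(inj_eq Some_inj) ab a1 a2 a3 b1 b2 b3 x12 x13 x23.
- move=> v x vV /PX[y [q [-> Py /and4P[_ pq aq bq]]]]; rewrite /w Py.
  move: vV; rewrite !inE => /or3P[] /eqP -> /=.
  + by move: pq; rewrite (inj_eq Some_inj) (negbTE ab) /= => /andP[->].
  + rewrite eqxx rev_cons map_rcons last_rcons; split=> //.
    rewrite -map_rcons apex_path -rev_cons.
    by move: pq; rewrite rev_walk rcons_path => /andP[].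
  + by [].
have wP v x y : x \in X -> y \in w v x -> y \in map Some (P x).
  move=> /PX[x' [q [-> Px _]]]; rewrite /w Px; case: ifP => _.
    by rewrite map_rev mem_rev.
  by rewrite inE => /eqP->; exact: mem_head.
have vP v x : v \in [:: Some a; Some b; None] -> x \in X -> v \notin map Some (P x).
  move=> vV /PX[x' [q [-> -> /and4P[_ _ aq bq]]]].
  by move: vV; rewrite !inE => /or3P[] /eqP ->; rewrite ?mem_map_Some ?None_map_Some.
have dP x x' y : x \in X -> x' \in X -> x != x' -> y \in map Some (P x) ->
    y \notin map Some (P x').
  move=> xX xX' xx /mapP[z zx ->]; rewrite mem_map_Some.
  suff : ~~ has (mem (P x)) (P x') by apply: contra => zx'; apply/hasP; exists z.
  move: xX xX' xx; rewrite !inE => /or3P[] /eqP-> /or3P[] /eqP ->;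
  by rewrite ?eqxx ?P1 ?P2 ?P3 // has_sym.
move=> v v' vV vV' vv x x' xX xX' xx; apply/hasPn => y yv; apply/negP => yv'.
move: yv yv'; rewrite !inE => /orP[/eqP->|/wP yx] /orP[/eqP e1|/wP yx'].
- by rewrite e1 eqxx in vv.
- by case/negP: (vP _ _ vV xX'); apply: yx'.
- by case/negP: (vP _ _ vV' xX); rewrite -e1; apply: yx.
- by case/negP: (dP _ _ _ xX xX' xx (yx xX)); apply: yx'.
Qed.

(** With the apex joined to all four vertices this is a K_5 in which only the edges from [d] to [a],
    [b], [c] may be longer walks. *)
Lemma vk_K4_free : K4_free.
Proof.
move=> a b c d pa pb pc un ab bc ca da db dc dis.
pose w (x y : option T) := if x == Some d then
   map Some (if y == Some a then rcons pa a else if y == Some b then rcons pb b else rcons pc c)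
  else [:: y].
move: (un); rewrite /= !inE !negb_or -!andbA andbT => /and5P[nab nac nad nbc /andP[nbd ncd]].
have wa : w (Some d) (Some a) = map Some (rcons pa a) by rewrite /w !eqxx.
have wb : w (Some d) (Some b) = map Some (rcons pb b).
  by rewrite /w (inj_eq Some_inj) eq_sym (inj_eq Some_inj) (negbTE nab) !eqxx.
have wc : w (Some d) (Some c) = map Some (rcons pc c).
  rewrite /w eqxx !(inj_eq Some_inj) ![c == _]eq_sym (negbTE nac) (negbTE nbc) //.
apply: (@vk_K5 _ _ _ _ vk (Some a) (Some b) (Some c) (Some d) None w).
- by rewrite /= !inE !(inj_eq Some_inj) !negb_or nab nac nad nbc nbd ncd.
- move=> x y; rewrite !inE !xpair_eqE; do !case/orP;
  case/andP => /eqP-> /eqP->; rewrite ?wa ?wb ?wc ?apex_path ?last_map ?last_rcons //;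
  by rewrite /w ?(inj_eq Some_inj) ?(negbTE nad) ?(negbTE nbd) ?(negbTE ncd) /= ?andbT.
set es := [:: _; _; _; _; _; _; _; _; _; _].
have inV x y : (x, y) \in es -> [/\ x \in [:: Some a; Some b; Some c; Some d; None]
    & y \in [:: Some a; Some b; Some c; Some d; None]].
  by rewrite !inE !xpair_eqE; do !case/orP; case/andP => /eqP-> /eqP->; rewrite !eqxx !orbT.
have notin y : y \in [:: Some a; Some b; Some c; Some d; None] -> y != Some d ->
    y \notin map Some (pa ++ pb ++ pc).
  rewrite !inE; do ?case/orP; move/eqP->;
  rewrite ?eqxx ?None_map_Some ?mem_map_Some // => _; apply: contra dis => h;
  by apply/hasP; eexists; first exact: h; rewrite /= !inE eqxx ?orbT.
have inw x y t : (x, y) \in es -> t \in x :: w x y ->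
    t \in [:: x; y] \/ x = Some d /\ t \in map Some (pa ++ pb ++ pc).
  move=> ixy; rewrite inE => /orP[/eqP->|]; first by left; rewrite mem_head.
  case: (eqVneq x (Some d)) ixy => [-> ixy | xd _]; last first.
    by rewrite /w (negbTE xd) => ty; left; rewrite inE ty orbT.
  have [p [-> sub]] : exists p, w (Some d) y = rcons (map Some p) y /\
      {subset p <= pa ++ pb ++ pc}.
    have /or3P[] : [|| y == Some a, y == Some b | y == Some c].
      move: (ixy); rewrite !inE !xpair_eqE !(inj_eq Some_inj) eqxx.
      by rewrite ![d == _]eq_sym (negbTE nad) (negbTE nbd) (negbTE ncd) /= orbF.
    - by move/eqP->; exists pa; rewrite wa map_rcons; split=> // z zp; rewrite mem_cat zp.
    - by move/eqP->; exists pb; rewrite wb map_rcons; split=> // z zp; rewrite !mem_cat zp orbT.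
    - by move/eqP->; exists pc; rewrite wc map_rcons; split=> // z zp; rewrite !mem_cat zp !orbT.
  rewrite mem_rcons inE => /orP[/eqP->|/mapP[z /sub zp ->]].
    by left; rewrite !inE eqxx orbT.
  by right; rewrite mem_map_Some.
move=> x y x' y' ixy ixy' U; apply/hasPn => t /= t'; apply/negP => t1.
have [xV yV] := inV _ _ ixy; have [xV' yV'] := inV _ _ ixy'.
move: U; rewrite /= !inE !negb_or -!andbA andbT => /and5P[n1 n2 n3 n4 /andP[n5 n6]].
(* A vertex inner to one walk and an end of the other would be an end different from [d], which
   [notin] forbids. If it is inner to both, both walks start at [d], against [n2]. *)
case: (inw _ _ _ ixy t') => [h|[e h]]; case: (inw _ _ _ ixy' t1) => [h'|[e' h']].
- move: h h'; rewrite !inE => /orP[] /eqP -> /orP[] /eqP E; move: n2 n3 n4 n5;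
  by rewrite E eqxx.
- have [tV td] : t \in [:: Some a; Some b; Some c; Some d; None] /\ t != Some d.
    by rewrite -{2}e'; move: h; rewrite in_cons mem_seq1 => /orP[] /eqP->.
  by rewrite (negbTE (notin t tV td)) in h'.
- have [tV td] : t \in [:: Some a; Some b; Some c; Some d; None] /\ t != Some d.
    by rewrite -{2}e; move: h'; rewrite in_cons mem_seq1 => /orP[] /eqP->; rewrite // eq_sym.
  by rewrite (negbTE (notin t tV td)) in h.
- by rewrite e e' eqxx in n2.
Qed.

End Apex.

(** * Interval colorings *)

Local Open Scope ring_scope.

(** * The palette at a single vertex *)

Section Palettes.
Variable T : finType.
Implicit Types (N : {set T}) (f g : T -> int).

(** [N] stands for the neighbours of a vertex and [f y] for the colour of the edge to [y], so that
    palettes are handled without naming edges. *)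
Definition balanced N f : Prop :=
  (forall y z i, y \in N -> z \in N -> f y <= i -> i <= f z ->
     exists2 w, w \in N & f w = i) /\
  (forall i, (#|[set y in N | f y == i]| <= 2)%N).

Lemma balanced_eq N f g : {in N, f =1 g} -> balanced N f -> balanced N g.
Proof.
move=> fg [int mul]; split=> [y z i yN zN|i].
  rewrite -!fg// => yi iz; have [w wN wi] := int y z i yN zN yi iz.
  by exists w; rewrite // -fg.
apply: leq_trans (mul i); apply/subset_leq_card/subsetP => w.
by rewrite !inE => /andP[wN]; rewrite wN -fg.
Qed.

Lemma balanced_small N f : (#|N| <= 1)%N -> balanced N f.
Proof.
move=> N1; split=> [y z i yN zN yi iz|i].
  exists y => //; have e : y = z by apply: (card_le1_eqP N1).
  by rewrite -e in iz; apply/eqP; rewrite eq_le yi iz.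
apply: leq_trans (leqW N1); apply/subset_leq_card/subsetP => w.
by rewrite inE => /andP[].
Qed.

Lemma color_class_mono N N' f m : (forall w, w \in N' -> w != m -> w \in N) ->
  (forall i, i != f m -> (#|[set y in N' | f y == i]| <= #|[set y in N | f y == i]|)%N).
Proof.
move=> sub i im; apply/subset_leq_card/subsetP => w.
rewrite !inE => /andP[wN /eqP wi]; rewrite wi eqxx andbT sub//.
by apply: contraNneq im => <-; rewrite wi.
Qed.

(** The new colour lies one step outside the palette, next to its extreme [f m], so [y] alone uses
    it. The sign [e] treats top and bottom at once. *)
Lemma balanced_extreme N f m y (e : int) : balanced N f -> m \in N -> y \notin N ->
  e = 1 \/ e = -1 -> (forall w, w \in N -> e * f w <= e * f m) ->
  f y = f m + e -> balanced (y |: N) f.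
Proof.
move=> [int mul] mN yN e1 em fy; split=> [w z i|i].
  rewrite !inE => wN zN wi iz.
  have [->|iy] := eqVneq i (f y); first by exists y; rewrite ?setU11.
  suff [v vN vi] : exists2 v, v \in N & f v = i.
    by exists v; rewrite // inE vN orbT.
  have := em m mN; case/orP: wN => [/eqP?|wN]; case/orP: zN => [/eqP?|zN]; subst.
  - by move=> _; exfalso; lia.
  - move=> _; have := em z zN; case: e1 => ?; subst => h.
      by exfalso; lia.
    by apply: (int m z); rewrite //; lia.
  - move=> _; have := em w wN; case: e1 => ?; subst => h; last by exfalso; lia.
    by apply: (int w m); rewrite //; lia.
  - by move=> _; apply: (int w z).
have [->|iy] := eqVneq i (f y).
  apply: leq_trans (_ : #|[set y]| <= _)%N; last by rewrite cards1.
  apply/subset_leq_card/subsetP => w; rewrite !inE => /andP[/orP[//|wN] /eqP wy].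
  by have := em w wN; case: e1 => ?; subst; lia.
apply: leq_trans (mul i); apply: (color_class_mono (m := y)) => // w.
by rewrite !inE => /orP[->|].
Qed.

Lemma balanced_repeat N f m y : balanced N f -> m \in N -> y \notin N ->
  (forall w, w \in N -> f w = f m -> w = m) -> f y = f m -> balanced (y |: N) f.
Proof.
move=> [int mul] mN yN sole fy; split=> [w z i|i].
  have pick w' : w' \in y |: N -> exists2 v, v \in N & f v = f w'.
    by rewrite !inE => /orP[/eqP->|w'N]; [exists m|exists w'].
  move=> /pick[w' w'N <-] /pick[z' z'N <-] wi iz.
  by have [v vN vi] := int _ _ _ w'N z'N wi iz; exists v; rewrite // inE vN orbT.
have [->|iy] := eqVneq i (f y).
  apply: leq_trans (_ : #|[set y; m]| <= _)%N; last by rewrite cards2; case: eqP.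
  apply/subset_leq_card/subsetP => w; rewrite !inE => /andP[/orP[->//|wN] /eqP wy].
  by rewrite (sole w) ?eqxx ?orbT// wy.
apply: leq_trans (mul i); apply: (color_class_mono (m := y)) => // w.
by rewrite !inE => /orP[->|].
Qed.

Lemma ex_max N f : N != set0 ->
  exists2 m, m \in N & forall w, w \in N -> f w <= f m.
Proof.
by case/set0Pn => x xN; case: (arg_maxP f xN) => m mN h; exists m.
Qed.

Lemma ex_min N f : N != set0 ->
  exists2 m, m \in N & forall w, w \in N -> f m <= f w.
Proof.
by case/set0Pn => x xN; case: (arg_minP f xN) => m mN h; exists m.
Qed.

(** The two palettes are disjoint adjacent intervals, so no colour class meets both sets. *)
Lemma balanced_stack N N' f m m' : balanced N f -> balanced N' f ->
  m \in N -> m' \in N' -> (forall w, w \in N -> f w <= f m) ->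
  (forall w, w \in N' -> f m' <= f w) -> f m' = f m + 1 -> balanced (N :|: N') f.
Proof.
move=> [int mul] [int' mul'] mN mN' mx mn mm; split=> [w z i|i].
  rewrite !inE => wN zN wi iz.
  suff [v vN vi] : exists2 v, (v \in N) || (v \in N') & f v = i.
    by exists v; rewrite // inE.
  have ex : (exists2 v, v \in N & f v = i) \/ (exists2 v, v \in N' & f v = i) ->
    exists2 v, (v \in N) || (v \in N') & f v = i.
    by move=> [[v vN vi]|[v vN vi]]; exists v; rewrite // vN ?orbT.
  apply: ex; have [im|im] := leP i (f m).
    left; case/orP: wN => wN; first exact: (int w m).
    by exists m => //; have := mn w wN; lia.
  right; case/orP: zN => zN; last by apply: (int' m' z) => //; lia.
  by exists m' => //; have := mx z zN; lia.
have [im|im] := leP i (f m).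
  apply: leq_trans (mul i); apply/subset_leq_card/subsetP => w.
  rewrite !inE => /andP[/orP[->//|wN] /eqP wi].
  by have := mn w wN; lia.
apply: leq_trans (mul' i); apply/subset_leq_card/subsetP => w.
rewrite !inE => /andP[/orP[wN|->//] /eqP wi].
by have := mx w wN; lia.
Qed.

Lemma balanced_shift N f k : balanced N f -> balanced N (fun w => f w + k).
Proof.
move=> [int mul]; split=> [y z i yN zN yi iz|i].
  have [||w wN wi] := int y z (i - k) yN zN; [lia|lia|].
  by exists w => //; lia.
apply: leq_trans (mul (i - k)); apply/subset_leq_card/subsetP => w.
by rewrite !inE => /andP[-> /eqP wi]; apply/eqP; lia.
Qed.

End Palettes.

(** * Gluing colourings along at most one common vertex *)

Section Glue.
Variables (T : finType) (adj : rel T).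
Hypotheses (adj_sym : symmetric adj) (adj_irr : irreflexive adj).
Implicit Types (S A B : {set T}) (c : {set T} -> int).

Definition nb S x : {set T} := [set y in S | adj x y].

Definition colored S c : Prop :=
  forall x, x \in S -> balanced (nb S x) (fun y => c [set x; y]).

Lemma colored_glue A B c1 c2 : (#|A :&: B| <= 1)%N ->
  (forall a b, a \in A :\: B -> b \in B :\: A -> ~~ adj a b) ->
  colored A c1 -> colored B c2 -> exists c, colored (A :|: B) c.
Proof.
move=> AB1 cross col1 col2.
(* No edge joins [A :\: B] to [B :\: A], so a vertex on one side only keeps its palette up to a
   shift, whatever [k] is. Only a common vertex constrains [k]. *)
have shifted k : (forall x, x \in A :&: B ->
      balanced (nb (A :|: B) x) (fun y => if [set x; y] \subset A then c1 [set x; y]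
                              else c2 [set x; y] + k)) ->
    exists c, colored (A :|: B) c.
  move=> good_x; exists (fun e : {set T} => if e \subset A then c1 e else c2 e + k) => x.
  rewrite inE; have [xA _|xA /= xB] := boolP (x \in A); last first.
    have -> : nb (A :|: B) x = nb B x.
      apply/setP => y; rewrite !inE; have [yB|yB] := boolP (y \in B); first by rewrite orbT.
      rewrite orbF; have [yA|//] := boolP (y \in A).
      by rewrite adj_sym; apply/negbTE/cross; rewrite inE ?xA ?xB ?yA ?yB.
    apply: (balanced_eq _ (balanced_shift k (col2 x xB))) => y _ /=.
    by rewrite subUset !sub1set (negbTE xA).
  have [xB|xB] := boolP (x \in B); first by apply: good_x; rewrite inE xA.
  have -> : nb (A :|: B) x = nb A x.
    apply/setP => y; rewrite !inE; have [//|yA /=] := boolP (y \in A).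
    have [yB|//] := boolP (y \in B).
    by apply/negbTE/cross; rewrite inE ?xA ?xB ?yA ?yB.
  apply: (balanced_eq _ (col1 x xA)) => y; rewrite inE => /andP[yA _] /=.
  by rewrite subUset !sub1set xA yA.
have [AB0|] := eqVneq (A :&: B) set0.
  by apply: (shifted 0) => x; rewrite AB0 inE.
case/set0Pn => x xAB; have [xA xB] : x \in A /\ x \in B by apply/setIP.
have only y : y \in A -> y \in B -> y = x.
  by move=> yA yB; apply: (card_le1_eqP AB1); rewrite // inE yA.
have nbU : nb (A :|: B) x = nb A x :|: nb B x.
  by apply/setP => y; rewrite !inE andb_orl.
have subA y : y \in nb A x -> [set x; y] \subset A.
  by rewrite inE subUset !sub1set xA => /andP[].
have subB y : y \in nb B x -> ([set x; y] \subset A) = false.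
  rewrite inE subUset !sub1set xA /= => /andP[yB xy]; apply: contraTF xy => yA.
  by rewrite (only y yA yB) adj_irr.
have goodA k : balanced (nb A x) (fun y => if [set x; y] \subset A then c1 [set x; y]
    else c2 [set x; y] + k).
  by apply: balanced_eq (col1 x xA) => y /subA ->.
have goodB k : balanced (nb B x) (fun y => if [set x; y] \subset A then c1 [set x; y]
    else c2 [set x; y] + k).
  by apply: balanced_eq (balanced_shift k (col2 x xB)) => y /subB ->.
have [A0|/(ex_max (fun y => c1 [set x; y]))[m mA mx]] := eqVneq (nb A x) set0.
  apply: (shifted 0) => y /setIP[yA yB]; rewrite (only y yA yB) nbU A0 set0U.
  exact: goodB.
have [B0|/(ex_min (fun y => c2 [set x; y]))[m' mB mn]] := eqVneq (nb B x) set0.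
  apply: (shifted 0) => y /setIP[yA yB]; rewrite (only y yA yB) nbU B0 setU0.
  exact: goodA.
(* This shift puts the least colour of [B] at [x] just above the greatest colour of [A] at [x]. *)
pose k := c1 [set x; m] - c2 [set x; m'] + 1.
apply: (shifted k) => y /setIP[yA yB]; rewrite (only y yA yB) nbU.
apply: (balanced_stack (goodA k) (goodB k) mA mB).
- by move=> w wA; rewrite /= !subA//; exact: mx.
- by move=> w wB; rewrite /= !subB//; have := mn w wB; lia.
- by rewrite (subA _ mA) (subB _ mB) /k; lia.
Qed.

End Glue.

(** * Neighbours on a cycle lengthened by an ear *)

Section CycleCat.
Variables (T : eqType) (v : T) (C p : seq T).
Hypothesis un : uniq (v :: C ++ p).
Let u := last v C.

(** The default [v] of [nth] is the wrap-around: beyond the last element the cycle returns to its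
    head. *)
Lemma next_index s x : x \in v :: s -> next (v :: s) x = nth v s (index x (v :: s)).
Proof. by move=> xs; rewrite next_nth xs. Qed.

(** When [v] is absent from [s], its index there is [size s], the place of the last element of
    [v :: s]; this closes the cycle backwards. *)
Lemma prev_index s x : x \in v :: s -> prev (v :: s) x = nth v (v :: s) (index x s).
Proof. by move=> xs; rewrite prev_nth xs. Qed.

Lemma index_last_lt x : x \in v :: C -> x != u -> (index x (v :: C) < size C)%N.
Proof.
move=> xC xu; have := xC; rewrite -index_mem [size (_ :: _)]/= ltnS leq_eqVlt.
case/orP=> [/eqP e|//]; case/eqP: xu.
by rewrite /u (last_nth v) -e nth_index.
Qed.

Lemma uniq_parts : [&& uniq (v :: C), ~~ has (mem (v :: C)) p & uniq p].
Proof. by rewrite -cat_uniq. Qed.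

Lemma mem_head_cat x : x \in v :: C -> x \in v :: C ++ p.
Proof. by rewrite -cat_cons mem_cat => ->. Qed.

Lemma mem_tail_cat x : x \in p -> x \in v :: C ++ p.
Proof. by rewrite -cat_cons mem_cat orbC => ->. Qed.

Lemma tail_notin x : x \in p -> x \notin v :: C.
Proof. by case/and3P: uniq_parts => _ /hasPn h _ /h. Qed.

Lemma head_notin : v \notin C.
Proof. by case/and3P: uniq_parts; rewrite cons_uniq => /andP[]. Qed.

Lemma next_cat_head x : x \in v :: C -> x != u -> next (v :: C ++ p) x = next (v :: C) x.
Proof.
move=> xC xu; rewrite !next_index ?mem_head_cat// -cat_cons index_cat xC nth_cat.
by rewrite index_last_lt.
Qed.

Lemma index_last : index u (v :: C) = size C.
Proof. by rewrite /u (last_nth v) index_uniq//; case/and3P: uniq_parts. Qed.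

Lemma next_cat_last : next (v :: C ++ p) u = nth v p 0.
Proof.
have uC : u \in v :: C by exact: mem_last.
rewrite next_index ?mem_head_cat// -cat_cons index_cat uC index_last.
by rewrite nth_cat ltnn subnn.
Qed.

Lemma next_last : next (v :: C) u = v.
Proof. by rewrite next_index ?mem_last// index_last nth_default. Qed.

Lemma next_cat_tail j : (j < size p)%N -> next (v :: C ++ p) (nth v p j) = nth v p j.+1.
Proof.
move=> jp; have xp : nth v p j \in p by rewrite mem_nth.
rewrite next_index ?mem_tail_cat// -cat_cons index_cat (negbTE (tail_notin xp)).
rewrite index_uniq//; last by case/and3P: uniq_parts.
by rewrite nth_cat [size (_ :: _)]/= addSnnS ltnNge leq_addr addKn.
Qed.

Lemma prev_cat_head x : x \in v :: C -> x != v -> prev (v :: C ++ p) x = prev (v :: C) x.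
Proof.
move=> xC xv; have xC' : x \in C by move: xC; rewrite inE (negbTE xv).
rewrite !prev_index ?mem_head_cat// index_cat xC' -cat_cons nth_cat.
by rewrite [size (_ :: _)]/= ltnS ltnW// index_mem.
Qed.

Lemma prev_cat_first : prev (v :: C ++ p) v = nth v (u :: p) (size p).
Proof.
rewrite prev_index ?mem_head// memNindex.
  by rewrite nth_last /= last_cat -/u -[last u p]/(last v (u :: p)) -nth_last.
rewrite mem_cat negb_or head_notin; apply/negP => /tail_notin.
by rewrite mem_head.
Qed.

Lemma prev_first : prev (v :: C) v = u.
Proof. by rewrite prev_index ?mem_head// memNindex ?head_notin// nth_last. Qed.

Lemma prev_cat_tail j : (j < size p)%N -> prev (v :: C ++ p) (nth v p j) = nth v (u :: p) j.
Proof.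
move=> jp; have xp : nth v p j \in p by rewrite mem_nth.
rewrite prev_index ?mem_tail_cat// index_cat.
have := tail_notin xp; rewrite inE negb_or => /andP[_ /negbTE ->].
rewrite index_uniq//; last by case/and3P: uniq_parts.
rewrite -cat_cons nth_cat [size (_ :: _)]/= ltnS.
case: j jp {xp} => [|j] jp; first by rewrite addn0 leqnn nth_last.
by rewrite leqNgt addnS ltnS leq_addr /= -addSn addKn.
Qed.

End CycleCat.

(** * The invariant of a coloured cycle and the addition of an ear *)

Section Extend.
Variables (T : finType) (adj : rel T).
Hypotheses (adj_sym : symmetric adj) (adj_irr : irreflexive adj).
Implicit Types (c : {set T} -> int) (C p : seq T).

Definition sole c C x y : Prop :=
  forall w, w \in C -> adj x w -> c [set x; w] = c [set x; y] -> w = y.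

(** The edges to [y] and [z] carry the two ends of the palette of [x]; the sign [e] leaves open
    which of them is the top. *)
Definition extremal c C x y z : Prop := exists e : int, (e = 1 \/ e = -1) /\
  forall w, w \in C -> adj x w ->
    e * c [set x; w] <= e * c [set x; z] /\ e * c [set x; y] <= e * c [set x; w].

(** The invariant of the ear construction. Palettes take in all edges among the vertices of [C],
    chords included, so a cycle through all of a vertex set yields a colouring of that set. *)
Definition cycle_colored C c : Prop :=
  [/\ [&& uniq C, cycle adj C & (1 < size C)%N],
      forall x, x \in C -> balanced (nb adj [set y in C] x) (fun y => c [set x; y]),
      forall x, x \in C -> extremal c C x (prev C x) (next C x) &
      forall x, x \in C -> sole c C x (next C x) \/ sole c C (next C x) x].

Lemma recolor c (n : nat) (edge : nat -> {set T}) (g : nat -> int) :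
  {in gtn n &, injective edge} ->
  exists c', (forall i, (i < n)%N -> c' (edge i) = g i) /\
    (forall e, (forall i, (i < n)%N -> e != edge i) -> c' e = c e).
Proof.
move=> inj; pose s := [seq edge i | i <- iota 0 n].
have us : uniq s.
  rewrite map_inj_in_uniq ?iota_uniq// => i j.
  by rewrite !mem_iota => /andP[_ i1] /andP[_ j1]; apply: inj.
exists (fun e => if e \in s then g (index e s) else c e); split=> [i lt_in | e he].
  have ei : edge i = nth set0 s i.
    by rewrite (nth_map 0) ?size_iota// nth_iota.
  have si : (i < size s)%N by rewrite size_map size_iota.
  by rewrite ei mem_nth// index_uniq.
case: ifP => // /mapP[i]; rewrite mem_iota => /andP[_ lt_in] E.
by case/eqP: (he i lt_in).
Qed.

(** The ear [p] replaces the closing edge from [u] to [v] on the cycle, and that edge remains as a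
    chord. The adjacency hypothesis makes the ear induced, so palettes change only at [u], at [v]
    and on the ear. *)
Lemma cycle_extend v C p c (u := last v C) :
  cycle_colored (v :: C) c -> p != [::] -> uniq (v :: C ++ p) ->
  path adj u (rcons p v) ->
  (forall j w, (j < size p)%N -> w \in v :: C ++ p -> adj (nth v p j) w ->
     w = nth v (u :: p) j \/ w = nth v p j.+1) ->
  (odd (size p) -> sole c (v :: C) v u) ->
  exists c', cycle_colored (v :: C ++ p) c'.
Proof.
move=> [/and3P[uC cyC szC] gC exC soC] p0 un pp ind so.
(* [q] lists the walk u, p, v: its end v is the default value of [nth]. *)
pose q j := nth v (u :: p) j; pose n := size p.
have n0 : (0 < n)%N by rewrite /n; case: (p) p0.
have vu : v != u.
  move: uC szC; rewrite /u; case: (C) => //= w C' /andP[nv _] _.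
  by apply: contraNneq nv => ->; exact: mem_last.
have uC' : u \in v :: C by exact: mem_last.
have disp x : x \in v :: C -> x \notin p.
  move: un; rewrite -cat_cons cat_uniq => /and3P[_ /hasPn dis _] xC.
  by apply/negP => /dis /=; rewrite xC.
have up : uniq p by move: un; rewrite -cat_cons cat_uniq => /and3P[].
have qp j : (0 < j <= n)%N -> q j \in p.
  by case: j => // j; rewrite /q /=; exact: mem_nth.
have qE j : q j = nth v (u :: rcons p v) j.
  by case: j => //= j; rewrite /q /= nth_rcons; case: ltnP => // h; rewrite nth_default//; case: eqP.
have uq : uniq (u :: rcons p v).
  rewrite /= mem_rcons inE negb_or eq_sym vu disp//= rcons_uniq up andbT.
  by apply: disp; rewrite mem_head.
have q_inj i j : (i <= n.+1)%N -> (j <= n.+1)%N -> q i = q j -> i = j.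
  have sz : size (u :: rcons p v) = n.+2 by rewrite /= size_rcons.
  by move=> i1 j1; rewrite !qE => /eqP; rewrite nth_uniq ?sz// => /eqP.
have qn : q n.+1 = v by rewrite /q /= nth_default.
pose edge j := [set q j; q j.+1].
have edge_inj : {in gtn n.+1 &, injective edge}.
  move=> i j; rewrite !inE !ltnS => i1 j1 E.
  have := set21 (q i) (q i.+1); rewrite -[[set _; _]]/(edge i) E => /set2P[/q_inj|/q_inj].
    by apply; exact: leqW.
  move=> /(_ (leqW i1) j1) ij.
  have := set22 (q i) (q i.+1); rewrite -[[set _; _]]/(edge i) E => /set2P[] /q_inj.
    by move=> /(_ i1 (leqW j1)); rewrite ij; clear; lia.
  by move=> /(_ i1 j1) [].
pose a := c [set u; v].
have [eu [eu1 exu]] := exC u uC'.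
have [ev' [ev1' exv]] := exC v (mem_head _ _).
rewrite (@next_last _ _ _ p un) in exu.
rewrite (@prev_first _ _ _ p un) in exv.
(* On the cycle [u] precedes [v], so in the direction [ev'] the colour [a] is the low end of the
   palette of [v]. Hence [ev] points out of that palette, as [eu] does at [u], where [v] is the
   successor. *)
pose ev := - ev'.
(* The ear edge from [q j] to [q j.+1] gets the color [a + f j].  If the ear has an
   even number of edges, the last one repeats the color [a] at [v]. *)
pose f j : int := if odd j then 0 else if j == n then ev else eu.
have [c' [c'edge c'old]] := recolor c (fun j => a + f j) edge_inj.
have {}c'old x y : x \in v :: C -> y \in v :: C -> c' [set x; y] = c [set x; y].
  move=> xC yC; apply: c'old => j jn; apply: contraTneq isT => E.
  have [z zS zp] : exists2 z, z \in [set x; y] & z \in p.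
    rewrite E; case: j jn {E} => [|j] jn.
      by exists (q 1%N); [rewrite set22|apply: qp].
    by exists (q j.+1); [rewrite set21|apply: qp].
  by case/set2P: zS => zE; move: zp; rewrite zE (negbTE (disp _ _)).
have c'e j : (j <= n)%N -> c' [set q j; q j.+1] = a + f j by exact: c'edge.
have c'e' j : (j <= n)%N -> c' [set q j.+1; q j] = a + f j by rewrite setUC; exact: c'e.
have f0 : f 0%N = eu by rewrite /f /= ifN // eq_sym -lt0n.
have fn : f n = if odd n then 0 else ev by rewrite /f eqxx.
(* An inner vertex of the ear sees just two ear edges; their colours differ by one, which settles
   its palette, its extremes and the uniqueness of both colours. *)
have fstep j : (j < n)%N -> f j.+1 - f j = 1 \/ f j.+1 - f j = -1.
  by move=> jn; rewrite /f /=; case: (odd j); rewrite /= ?subr0 ?sub0r; case: ifP => _;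
    move: eu1 ev1'; rewrite /ev; clear; lia.
have auv : adj u v.
  by move: cyC; rewrite /= rcons_path => /andP[].
have ca : c [set v; u] = a by rewrite setUC.
have exu_a w : w \in v :: C -> adj u w -> eu * c [set u; w] <= eu * a.
  by move=> wC uw; have [] := exu w wC uw.
have exv_a w : w \in v :: C -> adj v w -> ev * c [set v; w] <= ev * a.
  by move=> wC vw; have [] := exv w wC vw; rewrite ca /ev !mulNr lerN2.
have adj_p x w : x \in v :: C -> w \in p -> adj x w ->
    x = u /\ w = q 1%N \/ x = v /\ w = q n.
  move=> xC /(nthP v)[j jn <-]; rewrite adj_sym => xw.
  case: (ind j x jn (mem_head_cat _ xC) xw) => xE.
    left; case: j jn xE {xw} => [|j] jn xE //.
    by case/negP: (disp _ xC); rewrite xE; apply: mem_nth; apply: ltnW.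
  right; have [jn'|jn'] := ltnP j.+1 n.
    by case/negP: (disp _ xC); rewrite xE; exact: mem_nth.
  have -> : n = j.+1 by apply/eqP; rewrite eqn_leq jn' jn.
  by split; rewrite // xE nth_default.
have nb_old x : x \in v :: C -> x != u -> x != v ->
    nb adj [set y in v :: C ++ p] x = nb adj [set y in v :: C] x.
  move=> xC xu xv; apply/setP => w; rewrite !inE -!in_cons -cat_cons mem_cat.
  have [//|wC /=] := boolP (w \in v :: C); apply/negbTE/negP => /andP[wp xw].
  by case: (adj_p x w xC wp xw) => -[xE _]; rewrite xE eqxx in xu xv.
have nb_u : nb adj [set y in v :: C ++ p] u = q 1%N |: nb adj [set y in v :: C] u.
  apply/setP => w; rewrite !inE -!in_cons -cat_cons mem_cat.
  have [wC /=|wC /=] := boolP (w \in v :: C).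
    by rewrite orb_idl// => /eqP wq; move: wC; rewrite wq => /disp; rewrite qp.
  rewrite orbF; apply/andP/eqP => [[wp uw]|->].
    by case: (adj_p u w uC' wp uw) => -[] // uv; rewrite uv eqxx in vu.
  split; first by apply: qp.
  by move: pp; rewrite /q /=; case: (p) p0 => //= x p' _ /andP[].
have nb_v : nb adj [set y in v :: C ++ p] v = q n |: nb adj [set y in v :: C] v.
  apply/setP => w; rewrite !inE -!in_cons -cat_cons mem_cat.
  have [wC /=|wC /=] := boolP (w \in v :: C).
    by rewrite orb_idl// => /eqP wq; move: wC; rewrite wq => /disp; rewrite qp// n0 leqnn.
  rewrite orbF; apply/andP/eqP => [[wp uw]|->].
    by case: (adj_p v w (mem_head _ _) wp uw) => -[] // uv; rewrite -uv eqxx in vu.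
  split; first by apply: qp; rewrite n0 leqnn.
  move: pp; rewrite rcons_path => /andP[_]; rewrite adj_sym.
  by rewrite /q nth_last.
have nb_p j : (j < n)%N ->
    nb adj [set y in v :: C ++ p] (q j.+1) = [set q j; q j.+2].
  move=> jn; apply/setP => w; rewrite !inE -!in_cons; apply/andP/orP => [[wC qw]|].
    by have [->|->] := ind j w jn wC qw; [left|right].
  have qC i : (i <= n.+1)%N -> q i \in v :: C ++ p.
    case: i => [_|i]; first exact: mem_head_cat.
    rewrite leq_eqVlt => /orP[/eqP[->]|lt_in]; first by rewrite qn mem_head.
    by apply: mem_tail_cat; exact: qp.
  have qadj i : (i <= n)%N -> adj (q i) (q i.+1).
    move=> lt_in; have := elimT (pathP v) pp i; rewrite size_rcons ltnS => /(_ lt_in).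
    by rewrite (qE i) (qE i.+1).
  case=> /eqP ->; split.
  - by apply: qC; rewrite ltnW// ltnW.
  - by rewrite adj_sym; apply: qadj; exact: ltnW.
  - by apply: qC; rewrite ltnS.
  - by apply: qadj.
have val_u w : w \in v :: C -> c' [set u; w] = c [set u; w] by move=> wC; exact: c'old.
have val_v w : w \in v :: C -> c' [set v; w] = c [set v; w].
  by move=> wC; apply: c'old; rewrite // mem_head.
have c'u : c' [set u; q 1%N] = a + eu by rewrite (c'e 0%N) ?f0.
have c'v : c' [set v; q n] = a + f n by rewrite -qn c'e'.
have nxt x : x \in v :: C -> next (v :: C) x \in v :: C by move=> xC; rewrite mem_next.
have prv x : x \in v :: C -> prev (v :: C) x \in v :: C by move=> xC; rewrite mem_prev.
have nbs x w : w \in nb adj [set y in v :: C] x -> w \in v :: C by rewrite !inE => /andP[].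
have in_nb (s : seq T) x w : w \in s -> adj x w -> w \in nb adj [set y in s] x.
  by move=> ws xw; rewrite !inE ws.
have nb_in (s : seq T) x w : w \in nb adj [set y in s] x -> w \in s /\ adj x w.
  by rewrite !inE => /andP[].
exists c'; split.
- apply/and3P; split; rewrite ?un//.
    by move: cyC; rewrite /= !rcons_path cat_path last_cat -/u => /andP[-> _]; rewrite -rcons_path.
  by rewrite /= ltnS size_cat -/n addn_gt0 n0 orbT.
- move=> x; rewrite -cat_cons mem_cat cat_cons => /orP[xC|/(nthP v)[j jn <-]]; last first.
    rewrite -[nth v p j]/(q j.+1) nb_p//.
    have e1 : f j.+1 - f j = 1 \/ f j.+1 - f j = -1 by exact: fstep.
    rewrite setUC; apply: (balanced_extreme (m := q j) (e := f j.+1 - f j)) => //.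
    + by apply: balanced_small; rewrite cards1.
    + by rewrite inE.
    + rewrite inE; apply/eqP => /q_inj; move: (jn : (j < n)%N); clear; lia.
    + by move=> w; rewrite inE => /eqP->.
    + by rewrite c'e// c'e' 1?ltnW// addrA addrAC addrK.
  have gC' : balanced (nb adj [set y in v :: C] x) (fun y => c' [set x; y]).
    by apply: balanced_eq (gC x xC) => w /nbs wC; rewrite c'old.
  have [xu|xu] := eqVneq x u.
    rewrite xu nb_u; rewrite xu in gC'.
    apply: (balanced_extreme (m := v) (e := eu)) => //.
    + by apply: in_nb; rewrite ?mem_head.
    + by apply/negP => /nbs /disp; rewrite qp.
    + by move=> w /nb_in[wC uw]; rewrite !val_u ?mem_head//; exact: exu_a.
    + by rewrite c'u val_u ?mem_head.
  have [xv|xv] := eqVneq x v; last by rewrite nb_old.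
  rewrite xv nb_v; rewrite xv in gC'.
  have unb : u \in nb adj [set y in v :: C] v by apply: in_nb; rewrite // adj_sym.
  have qnb : q n \notin nb adj [set y in v :: C] v.
    by apply/negP => /nbs /disp; rewrite qp// n0 leqnn.
  have [on|on] := boolP (odd n).
    apply: (balanced_repeat (m := u)) => //.
    + by move=> w /nb_in[wC vw]; rewrite !val_v//; exact: so.
    + by rewrite c'v fn on addr0 val_v.
  apply: (balanced_extreme (m := u) (e := ev)) => //.
  + by rewrite /ev; case: ev1' => ->; [right|left].
  + by move=> w /nb_in[wC vw]; rewrite !val_v// ca; exact: exv_a.
  + by rewrite c'v fn (negbTE on) val_v// ca.
- move=> x; rewrite -cat_cons mem_cat cat_cons => /orP[xC|/(nthP v)[j jn <-]]; last first.
    rewrite next_cat_tail// prev_cat_tail// -[nth v p j]/(q j.+1) -/(q j) -[nth v p j.+1]/(q j.+2).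
    exists (f j.+1 - f j); split; first exact: fstep.
    move=> w wC qw; have := in_nb _ _ _ wC qw; rewrite nb_p// => /set2P[] ->;
    rewrite c'e// c'e' 1?ltnW//; case: (fstep j jn); clear; lia.
  have [xu|xu] := eqVneq x u.
    rewrite xu next_cat_last// -[nth v p 0]/(q 1%N) prev_cat_head// 1?eq_sym//.
    exists eu; split=> // w wC' uw; rewrite c'u (val_u (prev (v :: C) u)) ?prv//.
    have [_ h] := exu v (mem_head _ _) auv.
    have := in_nb _ _ _ wC' uw; rewrite nb_u => /setU1P[->|/nb_in[wC _]].
      by rewrite c'u; move: h; rewrite -/a; case: eu1 => ->; clear; lia.
    have [h1 h2] := exu w wC uw; rewrite val_u//.
    by move: h1 h2; rewrite -/a; case: eu1 => ->; clear; lia.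
  have [xv|xv] := eqVneq x v; last first.
    rewrite next_cat_head// prev_cat_head//.
    have [e [e1 ex]] := exC x xC; exists e; split=> // w wC' xw.
    have := in_nb _ _ _ wC' xw; rewrite nb_old// => /nb_in[wC _].
    by rewrite !c'old ?nxt ?prv//; exact: ex.
  rewrite xv next_cat_head ?mem_head// prev_cat_first// -/(q n).
  exists ev'; split=> // w wC' vw; rewrite c'v (val_v (next (v :: C) v)) ?nxt ?mem_head//.
  have vu' : adj v u by rewrite adj_sym.
  have [h _] := exv u uC' vu'.
  (* In the direction [ev'] the last ear edge has the colour [a] or the one just below, so it takes
     over the low end of the palette of [v]. *)
  have fn' : ev' * f n <= 0 by rewrite fn /ev; case: ifP => _; case: ev1' => ->.
  have := in_nb _ _ _ wC' vw; rewrite nb_v => /setU1P[->|/nb_in[wC _]].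
    by rewrite c'v; move: h fn'; rewrite ca; clear; lia.
  by have [h1 h2] := exv w wC vw; rewrite val_v//; move: h1 h2 fn'; rewrite ca; clear; lia.
move=> x; rewrite -cat_cons mem_cat cat_cons => /orP[xC|/(nthP v)[j jn <-]]; last first.
  rewrite next_cat_tail// -[nth v p j]/(q j.+1) -[nth v p j.+1]/(q j.+2); left.
  move=> w wC qw; have := in_nb _ _ _ wC qw; rewrite nb_p// => /set2P[] ->//.
  by rewrite c'e// c'e' 1?ltnW//; move=> E; exfalso; case: (fstep j jn); move: E; clear; lia.
have sole_u : sole c' (v :: C ++ p) (q 1%N) u.
  move=> w wC qw; have := in_nb _ _ _ wC qw; rewrite nb_p// => /set2P[] ->//.
  by rewrite (c'e 1%N)// (c'e' 0%N)//; move=> E; exfalso; case: (fstep 0%N n0); move: E; clear; lia.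
have [xu|xu] := eqVneq x u.
  by rewrite xu next_cat_last//; right.
rewrite next_cat_head//; set y := next (v :: C) x.
have yC : y \in v :: C by exact: nxt.
have xy : adj x y by exact: next_cycle.
case: (soC x xC); rewrite -/y => so_x.
  have [xv|xv] := eqVneq x v; last first.
    left=> w wC' xw; have := in_nb _ _ _ wC' xw; rewrite nb_old// => /nb_in[wC _].
    by rewrite !c'old//; exact: so_x.
  (* If [y] is [u], the cycle has length two and the edge at hand is the closing edge itself, whose
     colour the ear may repeat at [v]. At [u] it is still alone, the only other edge there having
     the colour [a + eu]. *)
  have [yu|yu] := eqVneq y u.
    have C1 : size C = 1%N.
      have : index y C = index u C by rewrite yu.
      rewrite /y xv next_index ?mem_head//= eqxx /u (last_nth v).
      have uC2 : uniq C by case/andP: uC.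
      case: (C) szC uC2 => // z C' _ uC2.
      by rewrite [size _]/= -[nth v (v :: _) _]/(nth v (z :: C') (size C')) !index_uniq// => <-.
    right; rewrite yu xv => w wC' uw.
    have := in_nb _ _ _ wC' uw; rewrite nb_u => /setU1P[->|/nb_in[wC _] _].
      by rewrite c'u val_u ?mem_head// -/a => E; exfalso; case: eu1 E => ->; clear; lia.
    move: wC; rewrite inE => /orP[/eqP//|wC].
    have wu : w = u by rewrite /u; case: (C) C1 wC => [|z []]//= _; rewrite inE => /eqP.
    by rewrite wu adj_irr in uw.
  left; rewrite xv in so_x xy * => w wC' vw.
  have := in_nb _ _ _ wC' vw; rewrite nb_v => /setU1P[->|/nb_in[wC _]].
    (* The new edge at [v] has either the colour [a], which by [so] is not that of the edge to [y],
       or a colour outside the old palette. *)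
    rewrite c'v val_v// fn; case: ifP => on.
      by rewrite addr0 -ca => E; case/eqP: yu; apply: (so on).
    by move=> E; exfalso; have := exv_a y yC xy; move: E; rewrite /ev; case: ev1' => ->; clear; lia.
  by rewrite !val_v//; exact: so_x.
have yv : y != v.
  apply: contraNneq xu => yv; rewrite -[x](@prev_next _ _ uC) -/y yv.
  by rewrite (@prev_first _ _ _ p un).
right; have [yu|yu] := eqVneq y u; last first.
  move=> w wC' yw; have := in_nb _ _ _ wC' yw; rewrite nb_old// => /nb_in[wC _].
  by rewrite !c'old//; exact: so_x.
rewrite yu in so_x xy * => w wC' uw.
have := in_nb _ _ _ wC' uw; rewrite nb_u => /setU1P[->|/nb_in[wC _]].
  rewrite adj_sym in xy; rewrite c'u val_u// => E; exfalso.
  by have := exu_a x xC xy; move: E; case: eu1 => ->; clear; lia.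
by rewrite !val_u//; exact: so_x.
Qed.

End Extend.

(** * Rotating and reversing a coloured cycle *)

Section Reorder.
Variables (T : finType) (adj : rel T).
Hypotheses (adj_sym : symmetric adj) (adj_irr : irreflexive adj).
Implicit Types (c : {set T} -> int) (C p : seq T).

(** The order of [C] enters the invariant only through [next] and [prev]. Exchanging these flips the
    sign in [extremal] and swaps the alternatives of [sole]. *)
Lemma cycle_colored_reorder C C' c : cycle_colored adj C c ->
  uniq C' -> cycle adj C' -> perm_eq C' C ->
  (next C' =1 next C /\ prev C' =1 prev C) \/ (next C' =1 prev C /\ prev C' =1 next C) ->
  cycle_colored adj C' c.
Proof.
move=> [/and3P[uC _ szC] gC exC soC] uC' cyC' pC dir.
have mC : C' =i C by exact: perm_mem.
have sC : [set y in C'] = [set y in C] by apply/setP => y; rewrite !inE mC.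
have so x y : sole adj c C x y -> sole adj c C' x y.
  by move=> h w; rewrite mC; exact: h.
split.
- by rewrite uC' cyC' (perm_size pC).
- by move=> x; rewrite mC sC; exact: gC.
- move=> x; rewrite mC => /exC[e [e1 ex]].
  case: dir => -[nE pE]; rewrite nE pE; [exists e | exists (- e)].
    by split=> // w; rewrite mC; exact: ex.
  split=> [|w]; first by case: e1 => ->; [right|left].
  by rewrite mC => wC xw; have [] := ex w wC xw; rewrite !mulNr !lerN2.
- move=> x; rewrite mC => xC; case: dir => -[nE pE]; rewrite nE.
    by case: (soC x xC) => /so; [left|right].
  have pxC : prev C x \in C by rewrite mem_prev.
  by case: (soC _ pxC); rewrite next_prev// => /so; [right|left].
Qed.

Lemma cycle_colored_rot i C c : cycle_colored adj C c -> cycle_colored adj (rot i C) c.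
Proof.
move=> col; have [/and3P[uC cyC _] _ _ _] := col.
apply: (cycle_colored_reorder col); rewrite ?rot_uniq ?rot_cycle ?perm_rot//.
by left; split=> x; [exact: next_rot | exact: prev_rot].
Qed.

Lemma cycle_colored_rev C c : cycle_colored adj C c -> cycle_colored adj (rev C) c.
Proof.
move=> col; have [/and3P[uC cyC _] _ _ _] := col.
apply: (cycle_colored_reorder col); rewrite ?rev_uniq ?perm_rev//.
- by rewrite rev_cycle (eq_cycle (e' := adj))// => x y; rewrite adj_sym.
- by right; split=> x; [exact: next_rev | exact: prev_rev].
Qed.

End Reorder.

(** * Shortest walks are chordless *)

Section Shortest.
Variables (T : finType) (adj : rel T) (D : {set T}) (u v : T).

Definition walk_in p := [&& p != [::], all (mem D) p & path adj u (rcons p v)].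

Lemma shortest_walk p0 : walk_in p0 ->
  exists2 p, walk_in p & forall p', walk_in p' -> (size p <= size p')%N.
Proof.
(* Tuples range over a finite type, so the existence of a walk of given length is decidable and a
   least length exists. *)
move=> w0; pose P n := [exists t : n.-tuple T, walk_in t].
have exP : exists n, P n by exists (size p0); apply/existsP; exists (in_tuple p0).
case: (ex_minnP exP) => n /existsP[t wt] mn; exists (tval t) => // p' w'.
by rewrite size_tuple; apply: mn; apply/existsP; exists (in_tuple p').
Qed.

Lemma last_take_nth p i : (i <= size p)%N -> last u (take i p) = nth v (u :: p) i.
Proof.
move=> ip; rewrite (last_nth v) size_takel//.
by rewrite -[u :: take i p]/(take i.+1 (u :: p)) nth_take.
Qed.

(** A chord would let the walk skip the vertices between its ends. The exception is an edge from [u]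
    to [v], where the shortcut would have no inner vertex. *)
Lemma shortest_chordless p (q := fun i => nth v (u :: p) i) : walk_in p ->
  (forall p', walk_in p' -> (size p <= size p')%N) ->
  forall i j, (i < j <= (size p).+1)%N -> adj (q i) (q j) ->
  j = i.+1 \/ (i = 0 /\ j = (size p).+1)%N.
Proof.
move=> /and3P[p0 pD pp] mn i j /andP[ij jp] aij.
have [|ji] := eqVneq j i.+1; first by left.
have [[-> ->]|nends] := pselect (i = 0 /\ j = (size p).+1)%N; first by right.
(* [q] starts with [u], so [q j] has place [j.-1] in [p]. For [j] equal to [(size p).+1] the suffix
   is empty and the shortcut ends directly in [v]. *)
exfalso; pose k := j.-1; pose p' := take i p ++ drop k p.
have jk : j = k.+1 by rewrite /k prednK//; lia.
have ip : (i <= size p)%N by lia.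
have kp : (k <= size p)%N by lia.
have sz : size p' = (i + (size p - k))%N.
  by rewrite size_cat size_takel// size_drop.
have : walk_in p'.
  apply/and3P; split.
  - by rewrite -size_eq0 sz; lia.
  - rewrite all_cat; apply/andP; split; apply/allP => x.
      by move=> /mem_take; exact: (allP pD).
    by move=> /mem_drop; exact: (allP pD).
  - rewrite rcons_cat -drop_rcons// cat_path last_take_nth//.
    move: (pp); rewrite rcons_path => /andP[pp' _]; rewrite take_path//=.
    rewrite (drop_nth v) ?size_rcons ?ltnS//=.
    have qj : nth v (rcons p v) k = q j.
      by rewrite jk /q /= nth_rcons; case: ltnP => // h; rewrite nth_default//; case: eqP.
    rewrite qj aij /=; move: pp; rewrite -{1}(cat_take_drop k.+1 (rcons p v)) cat_path.
    case/andP=> _; rewrite (last_nth v) size_takel ?size_rcons//.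
    rewrite -[u :: take _ _]/(take k.+2 (u :: rcons p v)) nth_take//=.
    by rewrite qj.
by move/mn; rewrite sz; lia.
Qed.

Lemma shortest_uniq p : walk_in p ->
  (forall p', walk_in p' -> (size p <= size p')%N) -> uniq p.
Proof.
move=> wp mn; apply/(uniqP v) => i j; rewrite !inE.
wlog ij : i j / (i <= j)%N.
  move=> h ip jp e; have [ij|ji] := leqP i j; first exact: h.
  by apply/esym/h => //; exact: ltnW.
move=> ip jp e; apply/eqP; rewrite eqn_leq ij /= leqNgt; apply/negP => lt_ij.
(* If places [i < j] of [p] hold the same vertex, the successor of the later one is adjacent to the
   earlier one, a forbidden chord. *)
have aj : adj (nth v (u :: p) j.+1) (nth v (u :: p) j.+2).
  case/and3P: wp => _ _ pp; have := elimT (pathP v) pp j.+1.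
  rewrite size_rcons ltnS => /(_ jp).
  have nr n : nth v (rcons p v) n = nth v p n.
    by rewrite nth_rcons; case: ltnP => // h; rewrite nth_default//; case: eqP.
  by rewrite /= !nr.
have ij' : (i.+1 < j.+2 <= (size p).+1)%N by rewrite ltnS ltnW.
have := shortest_chordless wp mn ij'; rewrite [nth _ _ i.+1]/= e => /(_ aj).
by case=> [[ji]|[]//]; rewrite ji ltnn in lt_ij.
Qed.

End Shortest.

(** * Ears of a cycle without thetas and K_4 *)

Section Structure.
Variables (T : finType) (adj : rel T).
Hypotheses (adj_sym : symmetric adj) (adj_irr : irreflexive adj).
Hypotheses (no_theta : theta_free adj) (no_K4 : K4_free adj).
Implicit Types (c : {set T} -> int) (C p : seq T).

(** If both arcs of the cycle between [x] and [y] had inner vertices, they would form a theta with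
    [p]. So one arc is a single edge. *)
Lemma cycle_ear C p x y : uniq C -> cycle adj C -> x \in C -> y \in C -> x != y ->
  link adj x y p -> ~~ has (mem C) p -> y = next C x \/ x = next C y.
Proof.
move=> uC cyC xC yC xy lp dis.
have [i C1 rotC] := rot_to xC.
have uC1 : uniq (x :: C1) by rewrite -rotC rot_uniq.
have mC : C =i x :: C1 by move=> z; rewrite -rotC mem_rot.
have nE z : next C z = next (x :: C1) z by rewrite -rotC next_rot.
have yC1 : y \in C1 by move: yC; rewrite mC inE eq_sym (negbTE xy).
rewrite !nE; have cy : cycle adj (x :: C1) by rewrite -rotC rot_cycle.
case: {mC nE rotC}(splitPr yC1) uC1 mC cy => A B uAB mC cy.
rewrite /= rcons_cat /= cat_path /= in cy; case/and3P: cy => pA Ay yB.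
have pxA : path adj x (rcons A y) by rewrite rcons_path pA.
have [A0|A0] := eqVneq A [::]; first by left; rewrite A0 /= eqxx.
have [B0|B0] := eqVneq B [::].
  right; rewrite B0 next_nth inE mem_cat inE eqxx !orbT.
  rewrite -cat_cons index_cat ifF.
    by rewrite /= eqxx addn0 nth_default// size_cat /= addn1.
  by move: uAB; rewrite B0 -cat_cons cat_uniq /= orbF => /and3P[_ /negbTE].
exfalso; move: uAB; rewrite -cat_cons cat_uniq /= negb_or.
move=> /and3P[/andP[xA _] /andP[yxA /hasPn dAB] /andP[yB' _]].
have xB : x \notin B by apply/negP => /dAB /=; rewrite inE eqxx.
have sub z : z \in A \/ z \in B -> z \in C.
  by move=> h; rewrite mC inE mem_cat inE; case: h => ->; rewrite !orbT.
have disP (L : seq T) : (forall z, z \in L -> z \in C) -> ~~ has (mem L) p.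
  by move=> LC; apply: contra dis => /hasP[z zp zL]; apply/hasP; exists z => //; exact: LC.
apply: (no_theta xy _ _ lp (p1 := A) (p2 := rev B)).
- rewrite /link A0 pxA xA /=; apply: contra yxA => yA; by rewrite inE yA orbT.
- rewrite /link -size_eq0 size_rev size_eq0 B0 -rev_walk// yB !mem_rev xB yB'//.
- by apply/hasPn => z; rewrite mem_rev => /dAB /=; rewrite inE negb_or => /andP[].
- by apply: disP => z zA; apply: sub; left.
- by apply: disP => z; rewrite mem_rev => zB; apply: sub; right.
Qed.

Lemma cycle_ear_adj C p x y : uniq C -> cycle adj C -> x \in C -> y \in C -> x != y ->
  link adj x y p -> ~~ has (mem C) p -> adj x y.
Proof.
move=> uC cyC xC yC xy lp dis.
case: (cycle_ear uC cyC xC yC xy lp dis) => ->; first exact: next_cycle.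
by rewrite adj_sym; exact: next_cycle.
Qed.

(** An ear vertex [x] joined to a third cycle vertex [t] yields ears from [u] to [t] and from [t] to
    [v]. By [cycle_ear_adj] the vertices [u], [v], [t] are pairwise adjacent, and the walks from [x]
    to them complete a K_4. *)
Lemma ear_attachment C p u v t x : uniq C -> cycle adj C ->
  u \in C -> v \in C -> t \in C -> u != v -> link adj u v p -> ~~ has (mem C) p ->
  x \in p -> adj x t -> t = u \/ t = v.
Proof.
move=> uC cyC uC' vC tC uv lp dis xp xt.
have [|tu] := eqVneq t u; first by left.
have [|tv] := eqVneq t v; first by right.
exfalso; have uv_adj := cycle_ear_adj uC cyC uC' vC uv lp dis.
have inC z : z \in C -> z \notin p.
  by move=> zC; apply: contra dis => zp; apply/hasP; exists z.
case/and4P: lp => _ + _ _; case: (splitPr xp) inC dis => A B inC dis.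
rewrite rcons_cat rcons_cons -cat_rcons cat_path last_rcons => /andP[pA pB].
have [inA inB inx] : [/\ forall z, z \in C -> z \notin A,
    forall z, z \in C -> z \notin B & forall z, z \in C -> z != x].
  by split=> z /inC; rewrite mem_cat inE !negb_or => /and3P[].
have ut_adj : adj u t.
  apply: (cycle_ear_adj uC cyC uC' tC (p := rcons A x)); first by rewrite eq_sym.
    rewrite /link -size_eq0 size_rcons /= rcons_path pA last_rcons xt !mem_rcons !inE.
    by rewrite !negb_or !inx// !inA.
  by apply/hasPn => z; rewrite mem_rcons inE => zA; apply/negP => zC;
    case/orP: zA => [/eqP zx|zA]; [have := inx z zC | have := inA z zC]; rewrite ?zx ?zA ?eqxx.
have tv_adj : adj t v.
  apply: (cycle_ear_adj uC cyC tC vC (p := x :: B)) => //.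
    by rewrite /link /= adj_sym xt pB !inE !negb_or !inx// !inB.
  by apply/hasPn => z; rewrite inE => zB; apply/negP => zC;
    case/orP: zB => [/eqP zx|zB]; [have := inx z zC | have := inB z zC]; rewrite ?zx ?zB ?eqxx.
apply: (no_K4 (a := u) (b := v) (c := t) (d := x) (pa := rev A) (pb := B) (pc := [::])) => //.
- by rewrite /= !inE !negb_or uv !inx// ![_ == t]eq_sym tu tv.
- by rewrite adj_sym.
- by rewrite adj_sym.
- by rewrite -rev_walk.
- by rewrite /= xt.
- rewrite cats0; apply/hasPn => z; rewrite mem_cat mem_rev => zAB.
  by rewrite !inE !negb_or; apply/and3P; split; apply: contraTneq zAB => ->;
    rewrite negb_or inA// inB.
Qed.

End Structure.

(** * Ear decomposition and colouring of all vertex sets *)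

Section Coloring.
Variables (T : finType) (adj : rel T).
Hypotheses (adj_sym : symmetric adj) (adj_irr : irreflexive adj).
Hypotheses (no_theta : theta_free adj) (no_K4 : K4_free adj).
Implicit Types (c : {set T} -> int) (C p : seq T) (S A B : {set T}).

(** An intersection of at most one vertex covers disconnected sets as well as cut vertices: this is
    connectedness without a cut vertex. *)
Definition inseparable S := forall A B, A :|: B = S -> (#|A :&: B| <= 1)%N ->
  (forall a b, a \in A :\: B -> b \in B :\: A -> ~~ adj a b) -> A = S \/ B = S.

(** [K] is the component of a vertex [d] off the cycle, [N] its set of attachments on the cycle.
    With at most one attachment, [K :|: N] and [S :\: K] would separate [S]; otherwise two
    attachments are joined by a walk through [K]. *)
Lemma ex_ear S C : inseparable S -> [set y in C] \proper S ->
  (exists2 x, x \in C & exists2 y, y \in C & x != y) ->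
  exists u v p, [/\ u \in C, v \in C, u != v & walk_in adj (S :\: [set y in C]) u v p].
Proof.
move=> insep /properP[CS [d dS dC]] [x0 x0C [y0 y0C xy0]].
pose D := S :\: [set y in C].
have dD : d \in D by rewrite inE dC.
pose e x y := [&& adj x y, x \in D & y \in D].
have es : symmetric e by move=> x y; rewrite /e adj_sym [(x \in D) && _]andbC.
pose K := [set y | connect e d y].
have walkD x p : x \in D -> path e x p -> path adj x p /\ all (mem D) (x :: p).
  elim: p x => [|y p IH] x xD /=; first by rewrite xD.
  case/andP=> /and3P[xy _ yD] /(IH _ yD)[-> /= ->]; by rewrite xy xD.
have KD : K \subset D.
  apply/subsetP => y; rewrite inE => /connectP[p /(walkD _ _ dD)[_ /allP pD] ->].
  by apply: pD; exact: mem_last.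
have dK : d \in K by rewrite inE connect0.
pose N := [set t in C | [exists y in K, adj y t]].
have [N1|/card_gt1P[u [v [uN vN uv]]]] := leqP #|N| 1.
  have NK t : t \in N -> t \notin K.
    rewrite inE => /andP[tC _]; apply/negP => /(subsetP KD).
    by rewrite !inE tC.
  have NS : N \subset S.
    by apply/subsetP => t; rewrite inE => /andP[tC _]; apply: (subsetP CS); rewrite inE.
  have KS : K \subset S by apply: subset_trans KD _; exact: subsetDl.
  have e1 : (K :|: N) :|: (S :\: K) = S.
    apply/eqP; rewrite eqEsubset !subUset KS NS subsetDl; apply/subsetP => z zS.
    by rewrite !inE zS andbT; case: (connect e d z); rewrite ?orbT.
  have e2 : (K :|: N) :&: (S :\: K) = N.
    apply/setP => z; rewrite [LHS]inE [z \in K :|: N]inE [z \in S :\: K]inE.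
    have [zN|zN] := boolP (z \in N); last by rewrite orbF; case: (z \in K).
    by rewrite orbT (NK z zN) (subsetP NS z zN).
  have [||/setP E|/setP E] := insep _ _ e1.
  - by rewrite e2.
  - move=> a b; rewrite !inE negb_or; case/andP=> aSK aKN /andP[/andP[bK bN] /andP[_ bS]].
    apply/negP => ab; have aK : connect e d a.
      case/orP: aKN => [//|/andP[aC aK]]; move: aSK; rewrite negb_and negbK => /orP[//|].
      by rewrite (subsetP CS) ?inE.
    have [bC|bC] := boolP (b \in C).
      by case/negP: bN; rewrite bC; apply/existsP; exists a; rewrite inE aK.
    have aD : a \in D by apply: (subsetP KD); rewrite inE.
    have bD : b \in D by rewrite !inE bC.
    by case/negP: bK; apply: connect_trans aK (connect1 _); rewrite /e ab aD.
  (* If [K :|: N] were all of [S], every cycle vertex would be an attachment, but the cycle has two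
     vertices and [N] at most one. *)
  - suff CN t : t \in C -> t \in N.
      by case/eqP: xy0; apply: (card_le1_eqP N1); exact: CN.
    move=> tC; have tS : t \in S by apply: (subsetP CS); rewrite inE.
    have := E t; rewrite tS inE => /orP[tK|//].
    by have := subsetP KD t tK; rewrite !inE tC.
  - by have := E d; rewrite inE dK dS.
move: uN vN; rewrite !inE => /andP[uC /existsP[y1 /andP[y1K y1u]]].
move=> /andP[vC /existsP[y2 /andP[y2K y2v]]].
have y1D := subsetP KD y1 y1K.
have : connect e y1 y2.
  rewrite !inE in y1K y2K; apply: connect_trans y2K.
  by rewrite (sym_connect_sym es).
case/connectP=> p /(walkD _ _ y1D)[pp pD] y2E.
exists u, v, (y1 :: p); split=> //; apply/and3P; split=> //.
by rewrite rcons_cons /= adj_sym y1u rcons_path pp -y2E.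
Qed.

Lemma walk_rev D u v p : walk_in adj D u v p -> walk_in adj D v u (rev p).
Proof.
case/and3P=> p0 pD pp; apply/and3P; split.
- by rewrite -size_eq0 size_rev size_eq0.
- by rewrite all_rev.
- by rewrite -rev_walk.
Qed.

Lemma walk_link S C u v p : u \in C -> v \in C ->
  walk_in adj (S :\: [set y in C]) u v p -> link adj u v p /\ ~~ has (mem C) p.
Proof.
move=> uC vC /and3P[p0 /allP pD pp].
have out z : z \in C -> z \notin p.
  by move=> zC; apply/negP => /pD; rewrite !inE zC.
split; first by rewrite /link p0 pp !out.
by apply/hasPn => z zp; apply/negP => zC; have := out z zC; rewrite zp.
Qed.

(** [ex_ear] provides an ear, [cycle_ear] makes its ends consecutive, and a shortest ear between the
    same ends is induced, as [cycle_extend] requires. *)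
Lemma cycle_grow S C c : inseparable S -> [set y in C] \proper S -> cycle_colored adj C c ->
  exists C' c', [/\ cycle_colored adj C' c', [set y in C'] \subset S & (size C < size C')%N].
Proof.
move=> insep CS col; have CsubS := proper_sub CS.
have [/and3P[uC cyC szC] _ _ soC] := col.
have [|u0 [v0 [p0 [u0C v0C uv0 w0]]]] := ex_ear insep CS.
  case: (C) uC szC => [|x [|y C']] //= /andP[xy _] _.
  exists x; first exact: mem_head; exists y; first by rewrite !inE eqxx orbT.
  by move: xy; rewrite inE negb_or => /andP[].
(* After reversing the cycle if necessary, [v] follows [u] and the edge to be replaced is the only
   one of its colour at [v]. *)
have [u [v [p1 [C1 [[uC1 vC1 uv w1] [[col1 mC1 szC1] [vu so]]]]]]] :
  exists u v p C', [/\ u \in C', v \in C', u != v & walk_in adj (S :\: [set y in C']) u v p] /\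
    [/\ cycle_colored adj C' c, C' =i C & size C' = size C] /\
    (v = next C' u /\ sole adj c C' v u).
  have dir u v p : u \in C -> v \in C -> u != v -> walk_in adj (S :\: [set y in C]) u v p ->
      v = next C u -> exists u v p C',
    [/\ u \in C', v \in C', u != v & walk_in adj (S :\: [set y in C']) u v p] /\
    [/\ cycle_colored adj C' c, C' =i C & size C' = size C] /\
    (v = next C' u /\ sole adj c C' v u).
    move=> uC' vC' uv w vE; case: (soC u uC'); rewrite -vE => so; last first.
      by exists u, v, p, C.
    exists v, u, (rev p), (rev C); rewrite !mem_rev eq_sym; split; [|split].
    - split=> //; have -> : [set y in rev C] = [set y in C] by apply/setP => z; rewrite !inE mem_rev.
      exact: walk_rev.
    - by split; [exact: cycle_colored_rev|exact: mem_rev|exact: size_rev].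
    - split; first by rewrite next_rev// vE prev_next.
      by move=> z; rewrite mem_rev; exact: so.
  have [lp dis] := walk_link u0C v0C w0.
  have [vE|uE] := cycle_ear adj_sym no_theta uC cyC u0C v0C uv0 lp dis.
    exact: dir w0 vE.
  by apply: dir (walk_rev w0) uE => //; rewrite eq_sym.
have [p wp mn] := shortest_walk w1.
have chord := shortest_chordless wp mn.
have up := shortest_uniq wp mn.
have [lp dis] := walk_link uC1 vC1 wp.
(* Rotated to start at [v], the cycle ends at [u], the form that [cycle_extend] uses. *)
have [i C0 rotC] := rot_to vC1.
have mC0 : v :: C0 =i C1 by move=> z; rewrite -rotC mem_rot.
have [/and3P[uniqC1 cyC1 _] _ _ _] := col1.
have uC0 : uniq (v :: C0) by rewrite -rotC rot_uniq.
have lastu : last v C0 = u.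
  have uC0' : uniq (v :: C0 ++ [::]) by rewrite cats0.
  rewrite -(prev_first uC0') -rotC prev_rot// vu prev_next//.
have uvp : uniq (v :: C0 ++ p).
  rewrite -cat_cons cat_uniq uC0 up andbT /=; apply: contra dis => /hasP[z zp zC].
  by apply/hasP; exists z; rewrite //= -mC0.
have col0 : cycle_colored adj (v :: C0) c by rewrite -rotC; exact: cycle_colored_rot.
case/and3P: (wp) => p_n0 pD pp.
have [c' col'] : exists c', cycle_colored adj (v :: C0 ++ p) c'.
  apply: (cycle_extend adj_sym adj_irr col0) => //; rewrite ?lastu//; last first.
    by move=> _ w; rewrite mC0; exact: so.
  (* A neighbour on the cycle is [u] or [v] by [ear_attachment]. Then, as for neighbours on the ear,
     an edge skipping places would be a chord of a shortest walk. *)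
  move=> j w jp; rewrite -cat_cons mem_cat mC0 => /orP[wC|wp'] aw.
    have := ear_attachment adj_sym no_theta no_K4 uniqC1 cyC1 uC1 vC1 wC uv lp dis
      (mem_nth v jp) aw.
    case=> wE; subst w.
      rewrite adj_sym in aw.
      case: (chord 0%N j.+1 (leqW jp) aw) => [[jE]|[_ [jE]]]; first by left; rewrite jE.
      by rewrite jE ltnn in jp.
    have jp1 : (j.+1 < (size p).+1 <= (size p).+1)%N by rewrite ltnS jp leqnn.
    have vE : nth v (u :: p) (size p).+1 = v by rewrite /= nth_default.
    rewrite -{2}vE in aw; case: (chord _ _ jp1 aw) => [[jE]|[//]].
    by right; rewrite -jE nth_default.
  case/(nthP v): wp' aw => k kp <- aw.
  have [kj|jk|kj] := ltngtP k j.
  - have b : (k.+1 < j.+1 <= (size p).+1)%N by rewrite ltnS kj leqW.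
    rewrite adj_sym in aw; case: (chord _ _ b aw) => [[jE]|[//]].
    by left; rewrite jE.
  - have b : (j.+1 < k.+1 <= (size p).+1)%N by rewrite ltnS jk leqW.
    case: (chord _ _ b aw) => [[jE]|[//]].
    by right; rewrite jE.
  - by rewrite kj adj_irr in aw.
exists (v :: C0 ++ p), c'; split=> //.
  apply/subsetP => z; rewrite inE -cat_cons mem_cat mC0 mC1 => /orP[zC|zp].
    by apply: (subsetP CsubS); rewrite inE.
  have : z \in S :\: [set y in C1] := allP pD z zp.
  by case/setDP.
have -> : size C = size (v :: C0) by rewrite -szC1 -rotC size_rot.
by rewrite -cat_cons size_cat -addn1 leq_add2l lt0n size_eq0.
Qed.

Lemma inseparable_colored S : inseparable S -> exists c, colored adj S c.
Proof.
move=> insep.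
have [S1|S2] := leqP #|S| 1.
  exists (fun=> 0) => x _; apply: balanced_small; apply: leq_trans S1.
  by apply/subset_leq_card/subsetP => y; rewrite inE => /andP[].
have [x xS] : exists x, x \in S by apply/set0Pn; rewrite -card_gt0 ltnW.
(* A vertex without neighbours in [S] could be split off, [S] having a second vertex. *)
have [/exists_inP[y yS xy]|/exists_inPn noy] := boolP [exists y in S, adj x y]; last first.
  have [|||E|E] := insep [set x] (S :\ x).
  - by rewrite setD1K.
  - by rewrite (_ : _ :&: _ = set0) ?cards0//; apply/setP => z; rewrite !inE; case: eqP.
  - by move=> a b /setDP[/set1P-> _] /setDP[/setD1P[_ bS] _]; exact: noy.
  - by rewrite -E cards1 in S2.
  - by have := setD11 x S; rewrite E xS.
have nxy : y != x by apply/eqP => E; rewrite E adj_irr in xy.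
(* An edge is a cycle of length two: each vertex has one neighbour, so a constant colouring
   satisfies the invariant. *)
have base : cycle_colored adj [:: y; x] (fun=> 0).
  have nbE z w : z \in [:: y; x] -> w \in [:: y; x] -> adj z w -> w = next [:: y; x] z.
    rewrite !inE => /orP[] /eqP-> /orP[] /eqP->; rewrite ?adj_irr// => _.
      by rewrite /= eqxx.
    by rewrite /= eqxx eq_sym (negbTE nxy).
  split.
  - by rewrite /= !inE nxy xy adj_sym xy.
  - move=> z zyx; apply: balanced_small; apply/card_le1_eqP => a b.
    have nbE' w : w \in nb adj [set y0 in [:: y; x]] z -> w = next [:: y; x] z.
      by rewrite inE => /andP[]; rewrite inE; exact: nbE.
    by move=> /nbE' -> /nbE' ->.
  - by move=> z _; exists 1; split=> [|w _ _]; [left|rewrite mulr0].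
  - by move=> z zyx; left=> w wyx zw _; exact: nbE.
have grow n C c : (#|S| - size C <= n)%N -> cycle_colored adj C c -> [set y in C] \subset S ->
    exists c, colored adj S c.
  elim: n C c => [|n IH] C c szn col CS.
    have [/and3P[uC _ _] gC _ _] := col.
    have CE : [set y in C] = S.
      apply/eqP; rewrite eqEcard CS cardsE (card_uniqP uC); lia.
    by exists c => z; rewrite -CE inE => zC; exact: gC.
  have [/and3P[uC _ _] gC _ _] := col.
  move: CS; rewrite subEproper => /orP[/eqP CE|CS].
    by exists c => z; rewrite -CE inE => zC; exact: gC.
  have [C' [c' [col' CS' sz]]] := cycle_grow insep CS col.
  by apply: IH col' CS'; lia.
apply: grow base _; first exact: leqnn.
by apply/subsetP => z; rewrite !inE => /orP[] /eqP->.
Qed.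

Lemma ex_colored S : exists c, colored adj S c.
Proof.
have [n] := ubnP #|S|; elim: n S => // n IH S; rewrite ltnS => Sn.
have [insep|] := pselect (inseparable S); first exact: inseparable_colored.
move=> /existsNP[A] /existsNP[B] /not_implyP[ABS] /not_implyP[AB1] /not_implyP[cross].
move=> /not_orP[nA nB].
have pr (X : {set T}) : X \subset S -> X <> S -> exists c, colored adj X c.
  move=> XS nX; apply: IH; apply: leq_trans Sn; apply: proper_card.
  by rewrite properEneq XS andbT; apply/eqP.
have [|c1 col1] := pr A _ nA; first by rewrite -ABS subsetUl.
have [|c2 col2] := pr B _ nB; first by rewrite -ABS subsetUr.
by rewrite -ABS; exact: colored_glue col1 col2.
Qed.

End Coloring.

Local Close Scope ring_scope.

(** * Drawings in the plane *)

From mathcomp Require Import all_classical all_reals all_analysis.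
From mathcomp Require Import lra.

Import Order.TTheory GRing.Theory Num.Theory.
Import numFieldNormedType.Exports.

Local Open Scope classical_set_scope.
Local Open Scope ring_scope.

(** * Counting crossings of the positive x-axis *)

Section Crossing.
Variable R : realType.
Implicit Types (z w p q : R * R).

(** The positive x-axis is included so that exactly one of [z] and [- z] qualifies unless [z] is
    zero; this gives the antisymmetry asked by [vk_trivial]. *)
Definition upper z : bool := (0 < z.2) || ((z.2 == 0) && (0 < z.1)).

(** If a step shorter than the norm of [z] changes half planes, both its ends have first coordinates
    of the same sign, so the sign is read at [z] only. *)
Definition crossing z w : bool := (upper z (+) upper w) && (0 < z.1).

Lemma upperN z : z != 0 -> upper (- z) = ~~ upper z.
Proof.
case: z => x y; rewrite xpair_eqE /upper /= !oppr_gt0 oppr_eq0.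
by case: (ltrgtP y 0) => //=; case: (ltrgtP x 0).
Qed.

(** If one of [z00], [z01], [z10] is at distance at least [d] from the x-axis, all four points are
    in the same half plane and both sides vanish. Otherwise these three have large first coordinates
    of the same sign, and either the crossings of the [z] or those of the [- z] count all changes of
    half plane. *)
Lemma crossing_square d z00 z01 z10 z11 :
  d <= `|z00| -> d <= `|z01| -> d <= `|z10| -> d <= `|z11| ->
  `|z00 - z01| < d -> `|z00 - z10| < d -> `|z00 - z11| < d ->
  `|z01 - z11| < d -> `|z10 - z11| < d -> `|z01 - z10| < d ->
  crossing (- z00) (- z01) (+) crossing (- z10) (- z11) (+)
  crossing z00 z10 (+) crossing z01 z11
  = upper z01 (+) upper z11 (+) upper z00 (+) upper z10.
Proof.
move=> d1 d2 d3 d4 c1 c2 c3 c4 c5 c6.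
have d0 : 0 < d by apply: le_lt_trans c1; exact: normr_ge0.
have nz z : d <= `|z| -> z != 0 by rewrite -normr_gt0; exact: lt_le_trans.
rewrite /crossing !upperN ?nz //=.
have far z : d <= `|z| -> d <= `|z.1| \/ d <= `|z.2|.
  by rewrite prod_normE le_max => /orP[]; [left|right].
have near z w : `|z - w| < d -> `|z.1 - w.1| < d /\ `|z.2 - w.2| < d.
  by rewrite prod_normE gt_max => /andP[].
have side (s t : R) : d <= `|s| -> `|s - t| < d -> (0 < t) = (0 < s) /\ t != 0.
  rewrite lter_norml ler_normr => /orP[] h /andP[h1 h2].
    have t0 : 0 < t by lra.
    by rewrite t0 gt_eqF//; split=> //; apply/esym; lra.
  have t0 : t < 0 by lra.
  by rewrite lt_eqF// !ltNge !ltW//; lra.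
have up z w : d <= `|z.2| -> `|z - w| < d -> upper w = upper z.
  move=> dz /near[_ zw]; have [e nw] := side _ _ dz zw.
  have nz2 : z.2 != 0 by rewrite -normr_gt0 (lt_le_trans d0).
  by rewrite /upper e (negbTE nz2) (negbTE nw).
have rt z w : d <= `|z.1| -> `|z - w| < d -> (0 < w.1) = (0 < z.1).
  by move=> dz /near[zw _]; have [] := side _ _ dz zw.
have rtN z : d <= `|z.1| -> (0 < - z.1) = ~~ (0 < z.1).
  move=> dz; have nz1 : z.1 != 0 by rewrite -normr_gt0 (lt_le_trans d0).
  by rewrite oppr_gt0 ltNge le_eqVlt eq_sym (negbTE nz1).
have [e1|e1] := far _ d1; last by rewrite (up _ _ e1 c1) (up _ _ e1 c2) (up _ _ e1 c3) !addbb.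
have [e2|e2] := far _ d2; last first.
  rewrite distrC in c1.
  by rewrite (up _ _ e2 c1) (up _ _ e2 c4) (up _ _ e2 c6) !addbb.
have [e3|e3] := far _ d3; last first.
  rewrite distrC in c2; rewrite distrC in c6.
  by rewrite (up _ _ e3 c2) (up _ _ e3 c5) (up _ _ e3 c6) !addbb.
rewrite !rtN// (rt _ _ e1 c1) (rt _ _ e1 c2).
by case: (0 < _) => /=; rewrite ?andbF ?andbT;
  case: (upper z00); case: (upper z01); case: (upper z10); case: (upper z11).
Qed.

End Crossing.

(** * Connectedness through chains of short steps *)

Lemma connected_rel (T : topologicalType) (K : set T) (E : T -> T -> Prop) :
  connected K -> (forall x y z, E x y -> E y z -> E x z) ->
  (forall x, K x -> \forall y \near x, K y -> E x y /\ E y x) ->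
  forall p q, K p -> K q -> E p q.
Proof.
move=> cK tr loc p q Kp Kq.
(* Near a point of [B], points of [K] are in [B]; near a point of [K] outside [B], they are outside.
   So [B] is open and closed in [K]. *)
pose B := K `&` [set y | E p y].
suff BK : B = K by move: Kq; rewrite -BK => -[].
apply: cK.
- by exists p; split=> //; have [] := nbhs_singleton (loc _ Kp) Kp.
- exists (interior [set z | K z -> E p z]); first exact: open_interior.
  apply/seteqP; split=> y [Ky py]; split=> //; last exact: (nbhs_singleton py).
  apply: filterS (loc _ Ky) => z yz Kz; apply: tr py _.
  by have [] := yz Kz.
- exists (~` interior [set z | K z -> ~ E p z]).
    by apply: open_closedC; exact: open_interior.
  apply/seteqP; split=> y [Ky py]; split=> //.
    by move=> /nbhs_singleton/(_ Ky).
  apply: contrapT => npy; apply: py.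
  apply: filterS (loc _ Ky) => z yz Kz pz; apply: npy; apply: tr pz _.
  by have [] := yz Kz.
Qed.

Section Chains.
Variables (R : realType) (V : normedModType R).
Implicit Types (p q : V) (Q F K : set V).

Definition step (d : R) : rel V := fun x y => `|x - y| < d.

(** Chains of arbitrarily small steps stand in for curves in [Q]: connected sets provide them, and
    their crossings are finite sums. *)
Definition chained Q p q : Prop :=
  forall d, 0 < d -> exists s : seq V,
    [/\ path (step d) p s, last p s = q & {in p :: s, forall x, Q x}].

Lemma chained_trans Q p q r : chained Q p q -> chained Q q r -> chained Q p r.
Proof.
move=> pq qr d d0; have [s [ps sq Qs]] := pq d d0.
have [t [pt <- Qt]] := qr d d0; exists (s ++ t).
rewrite cat_path ps last_cat sq pt; split=> // x.
rewrite -cat_cons mem_cat => /orP[/Qs//|xt]; apply: Qt.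
by rewrite inE xt orbT.
Qed.

Lemma chained_sub Q Q' p q : Q `<=` Q' -> chained Q p q -> chained Q' p q.
Proof.
move=> QQ' pq d /pq[s [ps sq Qs]]; exists s; split=> // x /Qs; exact: QQ'.
Qed.

Lemma connected_chained K p q : connected K -> K p -> K q -> chained K p q.
Proof.
move=> cK Kp Kq d d0.
pose E x y := K x -> exists s : seq V,
  [/\ path (step d) x s, last x s = y & {in x :: s, forall x, K x}].
suff: E p q by apply.
apply: (@connected_rel _ K E cK) => // [x y z xy yz Kx | x Kx].
  have [s [ps sy Ks]] := xy Kx.
  have [|t [pt tz Kt]] := yz; first by rewrite -sy; apply: Ks; exact: mem_last.
  exists (s ++ t); rewrite cat_path last_cat sy ps pt; split=> // v.
  rewrite -cat_cons mem_cat => /orP[/Ks//|vt]; apply: Kt.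
  by rewrite inE vt orbT.
have st y : K y -> `|x - y| < d -> E x y /\ E y x.
  move=> Ky xy; split=> _; [exists [:: y] | exists [:: x]];
  rewrite /= /step ?[`|y - x|]distrC xy; split=> // v;
  by rewrite !inE => /orP[] /eqP->.
apply/nbhs_normP; exists d => //= y xy Ky; exact: st.
Qed.

Lemma segment_chained Q p q :
  (forall t, 0 <= t <= 1 -> Q (p + t *: (q - p))) -> chained Q p q.
Proof.
move=> Qt; pose f t := p + t *: (q - p).
apply: (@chained_sub (f @` `[0, 1])).
  by move=> _ [t + <-]; rewrite /= in_itv => /Qt.
apply: connected_chained.
- apply: connected_continuous_connected; first exact: segment_connected.
  apply: continuous_subspaceT => t; apply: cvgD; first exact: cvg_cst.
  by apply: cvgZr_tmp; exact: cvg_id.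
- by exists 0; rewrite ?/f ?scale0r ?addr0//= in_itv/= lexx ler01.
- by exists 1; rewrite ?/f ?scale1r ?subrKC//= in_itv/= lexx ler01.
Qed.

Definition away F (d : R) : set V := [set x | forall y, F y -> d <= `|x - y|].

Lemma away_near F x : closed F -> ~ F x ->
  exists2 r, 0 < r & forall y, `|x - y| < r -> away F r y.
Proof.
move=> cF Fx; have : nbhs x (~` F) by apply: open_nbhs_nbhs; split; [exact: closed_openC|].
case/nbhs_normP => e /= e0 sub; exists (e / 2); first by rewrite divr_gt0.
move=> y xy z Fz; rewrite leNgt; apply/negP => yz; apply: (sub z) => //=.
by rewrite -(subrKA y) (le_lt_trans (ler_normD _ _))//; lra.
Qed.

Lemma compact_away K F : compact K -> closed F -> K `&` F = set0 ->
  exists2 d, 0 < d & K `<=` away F d.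
Proof.
move=> /compact_near_coveringP cK cF KF.
have : \forall d \near 0^'+, K `<=` away F d.
  apply: cK => x Kx.
  have [r r0 xr] : exists2 r, 0 < r & forall y, `|x - y| < r -> away F r y.
    by apply: away_near => // Fx; rewrite -[False]/(set0 x) -KF.
  exists ([set y | `|x - y| < r], [set d | d < r]) => /=.
    split; first by apply/nbhs_normP; exists r.
    exact: nbhs_right_lt.
  move=> [y d] /= [xy dr] z Fz.
  by rewrite (le_trans (ltW dr))// xr.
move=> h; have [d [Kd d0]] : exists d, K `<=` away F d /\ 0 < d.
  near (0 : R)^'+ => d; exists d; split; first by near: d; exact: h.
  by near: d; exact: nbhs_right_gt.
by exists d.
Unshelve. all: by end_near.
Qed.

(** One distance [d] from [F] serves all step lengths; it later bounds the distance from an apex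
    edge to the arcs that it has to avoid. *)
Definition reach F p q : Prop := exists2 d, 0 < d & chained (away F d) p q.

Lemma reach_sub F F' p q : F' `<=` F -> reach F p q -> reach F' p q.
Proof.
move=> FF [d d0 pq]; exists d => //; apply: chained_sub pq => x xF y /FF; exact: xF.
Qed.

Lemma reach_trans F p q r : reach F p q -> reach F q r -> reach F p r.
Proof.
move=> [d d0 pq] [e e0 qr]; exists (Num.min d e); first by rewrite lt_min d0.
by apply: (@chained_trans _ _ q); [apply: chained_sub pq|apply: chained_sub qr];
  move=> x xF y /xF; rewrite ge_min => ->; rewrite ?orbT.
Qed.

Lemma reach_near F p : closed F -> ~ F p ->
  exists2 r, 0 < r & forall q, `|p - q| < r -> reach F p q /\ reach F q p.
Proof.
move=> cF Fp; have [r r0 pr] := away_near cF Fp.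
exists r => // q pq; split; exists r => //; apply: segment_chained => t /andP[t0 t1];
  apply: pr.
  rewrite opprD addrA subrr add0r normrN normrZ ger0_norm// distrC.
  by rewrite (le_lt_trans _ pq)// ler_piMl.
have -> : p - (q + t *: (p - q)) = (1 - t) *: (p - q).
  by rewrite scalerBl scale1r opprD addrA.
rewrite normrZ ger0_norm ?subr_ge0//.
by rewrite (le_lt_trans _ pq)// ler_piMl// gerBl.
Qed.

Lemma reach_component F p q : closed F ->
  connected_component (~` F) p q -> reach F p q.
Proof.
move=> cF pq.
apply: (@connected_rel _ _ (reach F) (@component_connected _ (~` F) p)) => //.
- exact: reach_trans.
- move=> x /connected_component_sub Fx.
  have [r r0 xr] := reach_near cF Fx.
  by apply/nbhs_normP; exists r => //= y /xr.
- apply: connected_component_refl.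
  exact: connected_component_sub (connected_component_sym pq).
Qed.

End Chains.

(** Let [d] be at most every distance [r] between disjoint edges, and choose chains of steps below
    [d / 2]. Differences of points on disjoint edges have norm at least [d], and one step on each
    chain moves them by less than [d], as [crossing_square] asks; [n] counts crossings along the
    chosen chains. *)
Lemma vk_drawing (R : realType) (H : finType) (e : rel H) (pt : H -> R * R)
    (Q : H -> H -> set (R * R)) :
  injective pt ->
  (forall a b, e a b -> chained (Q a b) (pt a) (pt b)) ->
  (forall a b c d, e a b -> e c d -> a != c -> a != d -> b != c -> b != d ->
     exists2 r, 0 < r & forall x y, Q a b x -> Q c d y -> r <= `|x - y|) ->
  exists u n, vk_trivial e u n.
Proof.
move=> inj chQ far.
have ex_r (i : (H * H) * (H * H)) : exists r : R, 0 < r /\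
    (e i.1.1 i.1.2 -> e i.2.1 i.2.2 ->
     i.1.1 != i.2.1 -> i.1.1 != i.2.2 -> i.1.2 != i.2.1 -> i.1.2 != i.2.2 ->
     forall x y, Q i.1.1 i.1.2 x -> Q i.2.1 i.2.2 y -> r <= `|x - y|).
  case: i => -[a b] [c d] /=.
  have [] := pselect [/\ e a b, e c d, a != c, a != d & b != c /\ b != d].
    move=> [ab cd ac ad [bc bd]]; have [r r0 rP] := far _ _ _ _ ab cd ac ad bc bd.
    by exists r.
  by move=> no; exists 1; split=> // ab cd ac ad bc bd; case: no.
have [r rP] := choice ex_r.
pose d := \big[Order.min/1]_i r i.
have d0 : 0 < d by apply: lt_bigmin => // i _; have [] := rP i.
have ex_s (i : H * H) : exists s : seq (R * R), e i.1 i.2 ->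
    [/\ path (step (d / 2)) (pt i.1) s, last (pt i.1) s = pt i.2 &
        {in pt i.1 :: s, forall x, Q i.1 i.2 x}].
  case: i => a b /=; have [ab|nab] := boolP (e a b).
    by have [|s sP] := chQ _ _ ab (d / 2); [rewrite divr_gt0|exists s].
  by exists [::].
have [s sP] := choice ex_s.
exists (fun x y => upper (pt x - pt y)).
exists (fun v a b =>
  wsum (fun p q => crossing (p - pt v) (q - pt v)) (pt a) (s (a, b))).
split=> [x y xy | a b c d' ab cd ac ad bc bd].
  by rewrite -upperN ?opprB// subr_eq0 (inj_eq inj) eq_sym.
have [p1 l1 Q1] := sP (a, b) ab; have [p2 l2 Q2] := sP (c, d') cd.
rewrite /= in p1 l1 Q1 p2 l2 Q2.
have sep x y : x \in pt a :: s (a, b) -> y \in pt c :: s (c, d') -> d <= `|x - y|.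
  move=> /Q1 xQ /Q2 yQ; apply: le_trans (proj2 (rP ((a, b), (c, d'))) _ _ _ _ _ _ x y xQ yQ) => //.
  exact: bigmin_le.
have := @wsum_square _ _ (step (d / 2)) (step (d / 2))
  (fun x y y' => crossing (y - x) (y' - x)) (fun y x x' => crossing (x - y) (x' - y))
  (fun x y => upper (x - y)) (pt a) (s (a, b)) (pt c) (s (c, d')) _ p1 p2.
rewrite l1 l2; apply=> x x' y y' xs xs'; rewrite /step => xx ys ys' yy.
have := @crossing_square _ d (x - y) (x - y') (x' - y) (x' - y').
have tri (p q : R * R) : `|p| < d / 2 -> `|q| < d / 2 -> `|p + q| < d.
  by move=> p0 q0; rewrite (le_lt_trans (ler_normD _ _))//; lra.
have half (p : R * R) : `|p| < d / 2 -> `|p| < d by move=> h; apply: lt_le_trans h _; lra.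
rewrite !opprB; apply; try exact: sep.
- by rewrite addrC subrKA distrC; exact: half.
- by rewrite subrKA; exact: half.
- by rewrite [y' - x']addrC addrACA [- y + y']addrC; apply: tri; rewrite // distrC.
- by rewrite subrKA; exact: half.
- by rewrite addrC subrKA distrC; exact: half.
- by rewrite [y - x']addrC addrACA [- y' + y]addrC; apply: tri.
Qed.

(** The half plane where [l] exceeds [M] is convex and, [l] being at most the norm, keeps away from
    the ball containing [F]. So the straight segment works. *)
Lemma reach_halfspace (R : realType) (F : set (R * R)) (M : R) (l : R * R -> R) p q :
  (forall x, F x -> `|x| <= M) -> (forall x, l x <= `|x|) ->
  (forall p q t, l (p + t *: (q - p)) = l p + t * (l q - l p)) ->
  M < l p -> M < l q -> reach F p q.
Proof.
move=> FM ln lin Mp Mq; exists (Num.min (l p) (l q) - M).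
  by rewrite subr_gt0 lt_min Mp.
apply: segment_chained => t /andP[t0 t1] y /FM yM.
apply: le_trans (lerB_dist _ _); apply: lerB => //.
apply: le_trans (ln _); rewrite lin.
by case: (leP (l p) (l q)) => pq; nra.
Qed.

Lemma reach_far (R : realType) (F : set (R * R)) (M : R) (p : R * R) :
  0 <= M -> (forall x, F x -> `|x| <= M) -> M < `|p| -> reach F (M + 1, M + 1) p.
Proof.
move=> M0 FM Mp.
have M1 : M < M + 1 by rewrite ltrDl.
have n1 (x : R * R) : `|x.1| <= `|x| by rewrite prod_normE le_max lexx.
have n2 (x : R * R) : `|x.2| <= `|x| by rewrite prod_normE le_max lexx orbT.
have h1 := @reach_halfspace _ F M (fun x => x.1) _ _ FM
  (fun x => le_trans (ler_norm _) (n1 x)) (fun _ _ _ => erefl).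
have h2 := @reach_halfspace _ F M (fun x => x.2) _ _ FM
  (fun x => le_trans (ler_norm _) (n2 x)) (fun _ _ _ => erefl).
have nn (r : R) : - r <= `|r| by rewrite -normrN ler_norm.
have h1' p' q : M < - p'.1 -> M < - q.1 -> reach F p' q.
  apply: (@reach_halfspace _ F M (fun x => - x.1)) => // [x | p0 q0 t].
    exact: le_trans (nn _) (n1 x).
  by rewrite /= -[t *: _]/(t * _); lra.
have h2' p' q : M < - p'.2 -> M < - q.2 -> reach F p' q.
  apply: (@reach_halfspace _ F M (fun x => - x.2)) => // [x | p0 q0 t].
    exact: le_trans (nn _) (n2 x).
  by rewrite /= -[t *: _]/(t * _); lra.
move: Mp; rewrite prod_normE lt_max !real_ltr_normr ?num_real//.
(* Outside the square of radius [M], a point lies in one of four half planes. The corner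
   [(M + 1, M + 1)] is in two of them; the other two are reached through an adjacent corner. *)
move=> /orP[] /orP[] Mp.
- exact: h1.
- apply: (@reach_trans _ _ _ _ (- (M + 1), M + 1)); first exact: h2.
  by apply: h1' => //=; rewrite opprK.
- exact: h2.
- apply: (@reach_trans _ _ _ _ (M + 1, - (M + 1))); first exact: h1.
  by apply: h2' => //=; rewrite opprK.
Qed.

(** * Arcs, their distances and the outer face of a drawing *)

Section Drawing.
Variables (R : realType) (G : graph) (pos : G -> R * R) (arc : {set G} -> R -> R * R).
Hypothesis dr : planar_drawing pos arc.

Let img e := arc e @` `[0, 1].

Lemma arc_compact e : e \in edges G -> compact (img e).
Proof.
move=> eE; apply: continuous_compact; first exact: (arc_continuous dr).
exact: segment_compact.
Qed.

Lemma pos_img e v : e \in edges G -> v \in e -> img e (pos v).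
Proof.
move=> eE ve; have : (pos @` [set` e]) (pos v) by exists v.
by rewrite -(arc_ends dr eE) => -[] ->; [exists 0 | exists 1] => //;
  rewrite /= in_itv /= lexx ler01.
Qed.

Lemma img_cases e p : e \in edges G -> img e p ->
  (exists2 v, v \in e & p = pos v) \/ (exists2 t, t \in `]0, 1[ & p = arc e t).
Proof.
move=> eE [t + <-]; rewrite /= in_itv /= => /andP[t0 t1].
have ends s : s = 0 \/ s = 1 -> exists2 v, v \in e & arc e s = pos v.
  move=> s01; have : (pos @` [set` e]) (arc e s).
    by rewrite -(arc_ends dr eE); case: s01 => ->; [left|right].
  by move=> [v ve <-]; exists v.
have [->|nt0] := eqVneq t 0; first by left; apply: ends; left.
have [->|nt1] := eqVneq t 1; first by left; apply: ends; right.
by right; exists t; rewrite // in_itv /= !lt_neqAle t0 t1 eq_sym nt0 nt1.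
Qed.

Lemma pos_notin_img e v : e \in edges G -> v \notin e -> ~ img e (pos v).
Proof.
move=> eE ve /(img_cases eE)[[w we /(pos_inj dr) vw]|[t t01 /esym]].
  by rewrite vw we in ve.
exact: (arc_vertex dr).
Qed.

Lemma img_disjoint e f : e \in edges G -> f \in edges G ->
  (forall v, v \in e -> v \notin f) -> img e `&` img f = set0.
Proof.
move=> eE fE ef; apply/seteqP; split=> // p [/(img_cases eE)[[v ve ->]|[t t01 ->]]].
  by move=> /pos_notin_img; apply=> //; exact: ef.
move=> /(img_cases fE)[[v vf tv]|[s s01 ts]].
  by case: (arc_vertex dr eE t01 tv).
case: (eqVneq e f) => [ef'|nef]; last by case: (arc_disjoint dr eE fE nef t01 s01 ts).
have [x xe] : exists x, x \in e.
  move: (eE); rewrite inE => /existsP[x /existsP[y /andP[_ /eqP->]]].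
  by exists x; rewrite !inE eqxx.
by case/negP: (ef x xe); rewrite -ef'.
Qed.

Lemma img_connected e : e \in edges G -> connected (img e).
Proof.
move=> eE; apply: connected_continuous_connected; first exact: segment_connected.
exact: (arc_continuous dr).
Qed.

(* What the edge from the apex to [v] has to avoid. *)
Definition others (v : G) : set (R * R) :=
  \bigcup_(e in [set e | (e \in edges G) && (v \notin e)]) img e `|`
  pos @` [set w | w != v].

Lemma finite_bigcup_compact (I : finType) (D : set I) (F : I -> set (R * R)) :
  (forall i, D i -> compact (F i)) -> compact (\bigcup_(i in D) F i).
Proof.
move=> cF; have -> : \bigcup_(i in D) F i = \big[setU/set0]_(i <- enum I | i \in D) F i.
  rewrite -bigcup_seq_cond; apply: eq_bigcup => //; split=> i /=.
    by move=> /mem_set ->; rewrite mem_enum.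
  by move=> /andP[_ /set_mem].
by apply: bigsetU_compact => i /set_mem; exact: cF.
Qed.

Lemma others_closed v : closed (others v).
Proof.
apply: compact_closed; first exact: norm_hausdorff.
apply: compactU; last by apply/finite_compact/finite_image/finite_finset.
by apply: finite_bigcup_compact => e /= /andP[/arc_compact].
Qed.

Lemma others_pos v : ~ others v (pos v).
Proof.
move=> [[e /= /andP[eE ve]]|[w /= wv /(pos_inj dr) E]]; first exact: pos_notin_img.
by rewrite E eqxx in wv.
Qed.

Let X := drawing_support pos arc.

Lemma others_support v : others v `<=` X.
Proof.
move=> p [[e /= /andP[eE _] ep]|[w _ <-]]; first by right; exists e.
by left; exists w.
Qed.

Lemma support_compact : compact X.
Proof.
apply: compactU; first by apply/finite_compact/finite_image/finite_finset.
by apply: finite_bigcup_compact => e /arc_compact.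
Qed.

(** The component of a point of the outer face goes beyond a bound [M] of the drawing, where
    everything is reachable from one corner; so one apex serves the whole outer face. *)
Lemma outer_face_reach : exists z : R * R,
  ~ X z /\ forall p, outer_face X p -> reach X z p.
Proof.
have [M0 /= [M0r XM]] := compact_bounded support_compact.
pose M := Num.max M0 0 + 1.
have M_ge0 : 0 <= M by rewrite addr_ge0 // le_max lexx orbT.
have {}XM x : X x -> `|x| <= M.
  by apply: XM; rewrite ltr_pwDr// le_max lexx.
exists (M + 1, M + 1); split.
  move=> /XM; rewrite leNgt; apply/negP/negPn.
  rewrite prod_normE lt_max /=; apply/orP; left.
  by rewrite (lt_le_trans _ (ler_norm _)) ?ltrDl.
move=> p [Xp unb].
have [y [py yM]] : exists y, connected_component (~` X) p y /\ M < `|y|.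
  apply: contrapT => no; apply: unb.
  exists M; split=> [|M' MM' y /= py]; first exact: num_real.
  by apply: le_trans (ltW MM'); rewrite leNgt; apply/negP => My; apply: no; exists y.
apply: (@reach_trans _ _ _ _ y); first exact: reach_far.
apply: reach_component; last exact: connected_component_sym.
by apply: compact_closed support_compact; exact: norm_hausdorff.
Qed.

End Drawing.

(** The apex edge to [v] goes from [z] to a point of the outer face close to [v], away from the
    whole drawing, and then straight to [v], away from [others pos arc v], which is closed and
    misses [pos v]. *)
Lemma outerplanar_vk (R : realType) (G : graph) : outerplanar R G ->
  exists u n, vk_trivial (apex (@adj G)) u n.
Proof.
move=> [pos [arc [dr out]]].
have [z [Xz reachz]] := outer_face_reach dr.
pose F := others pos arc.
have ex_d v : exists d, 0 < d /\ chained (away (F v) d) z (pos v).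
  suff [d d0 ch] : reach (F v) z (pos v) by exists d.
  have [r r0 near] := reach_near (@others_closed _ _ _ _ dr v) (@others_pos _ _ _ _ dr v).
  have [q [qO qv]] : outer_face (drawing_support pos arc) `&` ball (pos v) r !=set0.
    by apply: out; exact: nbhsx_ballx.
  apply: (@reach_trans _ _ _ _ q).
    by apply: reach_sub (reachz _ qO); exact: others_support.
  by have [|] := near q; first by move: qv; rewrite -ball_normE.
have [d dP] := choice ex_d.
pose pt x := if x is Some v then pos v else z.
(* An apex edge is given the whole set of points at distance at least [d v] from [F v], so its
   distance from the edges missing [v] is immediate. *)
pose Q (x y : option G) : set (R * R) := match x, y with
  | Some x, Some y => arc [set x; y]%SET @` `[0, 1]
  | None, Some v => away (F v) (d v)
  | _, _ => set0 end.
have edge x y : adj x y -> [set x; y]%SET \in edges G.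
  by move=> xy; rewrite inE; apply/existsP; exists x; apply/existsP; exists y; rewrite xy eqxx.
have away_edge v x y : adj x y -> v != x -> v != y -> forall p q,
    away (F v) (d v) p -> (arc [set x; y]%SET @` `[0, 1]) q -> d v <= `|p - q|.
  move=> xy vx vy p q pF qA; apply: pF; left; exists [set x; y]%SET => //=.
  by rewrite edge// !inE negb_or vx.
apply: (@vk_drawing R _ _ pt Q).
- have zpos v : z <> pos v by move=> zv; apply: Xz; left; exists v.
  move=> [v|] [w|] //= e; first by rewrite (pos_inj dr e).
  + by case: (zpos v).
  + by case: (zpos w).
- move=> [x|] [y|] //= xy; last by have [] := dP y.
  apply: connected_chained; first exact: (img_connected dr (edge _ _ xy)).
    by apply: (pos_img dr (edge _ _ xy)); rewrite !inE eqxx.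
  by apply: (pos_img dr (edge _ _ xy)); rewrite !inE eqxx orbT.
move=> [x|] [y|] [x'|] [y'|] //= xy xy'; rewrite ?(inj_eq Some_inj) => n1 n2 n3 n4.
- have [|r r0 rP] := compact_away (arc_compact dr (edge _ _ xy))
    (compact_closed (@norm_hausdorff _ _) (arc_compact dr (edge _ _ xy'))).
    apply: (img_disjoint dr); [exact: edge|exact: edge|] => v.
    rewrite !inE negb_or => /orP[] /eqP->; first by rewrite n1.
    by rewrite n3.
  by exists r => // p q /rP; apply.
- exists (d y'); first by have [] := dP y'.
  by move=> p q pQ qQ; rewrite distrC; apply: away_edge qQ pQ => //; rewrite eq_sym.
- exists (d y); first by have [] := dP y.
  by move=> p q pQ qQ; apply: away_edge pQ qQ.
Qed.

Local Close Scope ring_scope.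
Local Close Scope classical_set_scope.

(** * From palettes of neighbours to impropriety *)

Lemma incidentP (G : graph) (v : G) (e : {set G}) :
  reflect (exists2 w, adj v w & e = [set v; w]%SET) (e \in incident v).
Proof.
rewrite !inE; apply: (iffP andP) => [[/existsP[x /existsP[y /andP[xy /eqP->]]]]|[w vw ->]].
  rewrite !inE => /orP[] /eqP->; first by exists y.
  by exists x; [rewrite adj_sym | rewrite finset.setUC].
split; last by rewrite !inE eqxx.
by apply/existsP; exists v; apply/existsP; exists w; rewrite vw eqxx.
Qed.

Lemma colored_impropriety (G : graph) (c : {set G} -> int) :
  colored (@adj G) [set: G]%SET c ->
  improper_interval_coloring c /\ impropriety_le c 2.
Proof.
move=> col; split=> v; have [int mul] := col v (finset.in_setT v).
  move=> _ _ [e1 /incidentP[y vy ->] <-] [e2 /incidentP[z vz ->] <-] i /andP[yi iz].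
  have yN : y \in nb (@adj G) [set: G]%SET v by rewrite !inE.
  have zN : z \in nb (@adj G) [set: G]%SET v by rewrite !inE.
  have [w] := int _ _ _ yN zN yi iz; rewrite !inE => vw wi.
  by exists [set v; w]%SET => //; apply/incidentP; exists w.
move=> i; apply: leq_trans (mul i).
(* Sending a neighbour [w] to the edge [[set v; w]] is injective, so colour classes of edges at [v]
   are counted by neighbours. *)
rewrite -(card_in_imset (f := fun w => [set v; w]%SET)).
  apply/subset_leq_card/fintype.subsetP => e; rewrite inE => /andP[/incidentP[w vw ->] ci].
  by apply/imsetP; exists w => //; rewrite !inE vw.
move=> x y; rewrite !inE => /andP[vx _] /andP[vy _] /setP E.
have := E x; rewrite !inE eqxx orbT => /esym/orP[]/eqP// xv.
by rewrite xv adj_irr in vx.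
Qed.

Theorem theorem1p1 (R : realType) (G : graph) (hG : outerplanar R G) :
  (mu_int G <= 2)%N /\
  exists c : {set G} -> int,
    improper_interval_coloring c /\
    forall (v : G) (i : int), (#|[set e in incident v | c e == i]%SET| <= 2)%N.
Proof.
have [u [n vk]] := outerplanar_vk hG.
have [c col] : exists c, colored (@adj G) [set: G]%SET c.
  apply: (ex_colored (@adj_sym G) (@adj_irr G)).
  - exact: vk_theta_free (@adj_sym G) _ _ vk.
  - exact: vk_K4_free vk.
have [ci cm] := colored_impropriety col.
split; last by exists c.
rewrite /mu_int; case: ex_minnP => m _; apply.
by apply/asboolP; exists c.
Qed.
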